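(* Let $(X_1,X_2,Y)$ be random variables with joint pmf $p(x_1,x_2,y)$ on a product of finite alphabets $\mathcal{X}_1\times\mathcal{X}_2\times\mathcal{Y}$ such that $X_1-X_2-Y$ is a Markov chain. Then $$\tilde{\mathcal{R}}_{\text{CDIB}}(1)=\hat{\mathcal{R}}_{\text{CDIB}}(1)=\mathcal{R}_{\text{CDIB}}(1).$$
   Context: All logarithms are base 2. $A-B-C$ denotes a Markov chain, i.e. $p(a|b,c)=p(a|b)$. Operational region. Let $(X_1^n,X_2^n,Y^n)$ be $n$ i.i.d. copies of $(X_1,X_2,Y)$. A $1$-step $n$-length CDIB code consists of finite message sets $\mathcal{I}_1,\mathcal{J}_1$ and mappings $f_1:\mathcal{X}_1^n\to\mathcal{I}_1$, $g_1:\mathcal{X}_2^n\times\mathcal{I}_1\to\mathcal{J}_1$; the messages are $I_1=f_1(X_1^n)$, $J_1=g_1(X_2^n,I_1)$. A triple $(R_1,R_2,\mu)\in\mathbb{R}^3_{\geq0}$ is $1$-achievable if for every $\varepsilon>0$ there is $n_0(\varepsilon)$ such that for all $n>n_0(\varepsilon)$ there is such a code with $\frac1n\log|\mathcal{I}_1|\leq R_1+\varepsilon$, $\frac1n\log|\mathcal{J}_1|\leq R_2+\varepsilon$ and $\mu-\varepsilon\leq\frac1nI(Y^n;I_1J_1)$. $\mathcal{R}_{\text{CDIB}}(1)$ is the set of all $1$-achievable triples. $\hat{\mathcal{R}}_{\text{CDIB}}(1)$ is the set of $(R_1,R_2,\mu)\in\mathbb{R}^3_{\geq0}$ for which there is a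 joint pmf $p(x_1,x_2,y,v_1,v_2)$ (finite-alphabet $V_1,V_2$) preserving the joint distribution of $(X_1,X_2,Y)$, with $$R_1\geq I(X_1;V_1),\quad R_2\geq I(X_2;V_2|V_1),\quad \mu\leq I(Y;V_1V_2),$$ and Markov chains $V_1-X_1-(X_2,Y)$ and $V_2-(V_1,X_1,X_2)-Y$. $\tilde{\mathcal{R}}_{\text{CDIB}}(1)$ is defined by the same three inequalities, but with Markov chains $V_1-X_1-(X_2,Y)$ and $V_2-(V_1,X_2)-(X_1,Y)$. *)

(* Defs.v *)
From mathcomp Require Import all_boot all_order all_algebra.
From mathcomp Require Import all_classical all_reals all_analysis.

Set Implicit Arguments.
Unset Strict Implicit.
Unset Printing Implicit Defensive.

Import Order.TTheory GRing.Theory Num.Theory.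

Local Open Scope ring_scope.
Local Open Scope classical_set_scope.

Definition log2 (R : realType) (x : R) : R := ln x / ln 2.

Definition is_pmf (R : realType) (T : finType) (p : T -> R) : Prop :=
  (forall t, 0 <= p t) /\ \sum_t p t = 1.

(* A random variable on a finite probability space (W, p) is a function on W. *)

Definition rv_pair (W A B : Type) (X : W -> A) (Y : W -> B) : W -> A * B :=
  fun w => (X w, Y w).

Notation "[% X , Y , .. , Z ]" := (rv_pair .. (rv_pair X Y) .. Z).

Definition law (R : realType) (W A : finType) (p : W -> R) (X : W -> A)
    (a : A) : R :=
  \sum_(w | X w == a) p w.

(* p(a | b); the value is 0 when p(b) = 0. *)
Definition cond_law (R : realType) (W A B : finType) (p : W -> R)
    (X : W -> A) (Y : W -> B) (a : A) (b : B) : R :=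
  law p [% X, Y] (a, b) / law p Y b.

(* Terms of probability 0 vanish, whatever the value of their logarithm, which
   encodes the convention 0 log 0 = 0. *)
Definition mutual_info (R : realType) (W A B : finType) (p : W -> R)
    (X : W -> A) (Y : W -> B) : R :=
  \sum_(a : A) \sum_(b : B)
    law p [% X, Y] (a, b) *
    log2 (law p [% X, Y] (a, b) / (law p X a * law p Y b)).

Definition cond_mutual_info (R : realType) (W A B C : finType) (p : W -> R)
    (X : W -> A) (Y : W -> B) (Z : W -> C) : R :=
  \sum_(a : A) \sum_(b : B) \sum_(c : C)
    law p [% X, Y, Z] (a, b, c) *
    log2 (cond_law p [% X, Y] Z (a, b) c /
          (cond_law p X Z a c * cond_law p Y Z b c)).

(* X - Y - Z : p(a | b, c) = p(a | b) wherever p(a | b, c) is defined. *)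
Definition markov_chain (R : realType) (W A B C : finType) (p : W -> R)
    (X : W -> A) (Y : W -> B) (Z : W -> C) : Prop :=
  forall (a : A) (b : B) (c : C), law p [% Y, Z] (b, c) != 0 ->
    cond_law p X [% Y, Z] a (b, c) = cond_law p X Y a b.

Definition src_X1 (A1 A2 B : Type) (s : A1 * A2 * B) : A1 := s.1.1.
Definition src_X2 (A1 A2 B : Type) (s : A1 * A2 * B) : A2 := s.1.2.
Definition src_Y (A1 A2 B : Type) (s : A1 * A2 * B) : B := s.2.

Definition iid_pmf (R : realType) (T : finType) (p : T -> R) (n : nat)
    (s : {ffun 'I_n -> T}) : R :=
  \prod_(i < n) p (s i).

Definition map_seq (T A : finType) (X : T -> A) (n : nat)
    (s : {ffun 'I_n -> T}) : {ffun 'I_n -> A} :=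
  [ffun i => X (s i)].

Record CDIB_code (A1 A2 : finType) (n : nat) := CDIBCode {
  msg1 : finType;
  msg2 : finType;
  enc1 : {ffun 'I_n -> A1} -> msg1;
  enc2 : {ffun 'I_n -> A2} * msg1 -> msg2
}.

Definition code_I1 (A1 A2 B : finType) (n : nat) (c : CDIB_code A1 A2 n)
    (s : {ffun 'I_n -> A1 * A2 * B}) : msg1 c :=
  enc1 c (map_seq (@src_X1 A1 A2 B) s).

Definition code_J1 (A1 A2 B : finType) (n : nat) (c : CDIB_code A1 A2 n)
    (s : {ffun 'I_n -> A1 * A2 * B}) : msg2 c :=
  enc2 (map_seq (@src_X2 A1 A2 B) s, code_I1 c s).

Definition R_CDIB (R : realType) (A1 A2 B : finType) (p : A1 * A2 * B -> R) :
    set (R * R * R) :=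
  [set r : R * R * R | let: (R1, R2, mu) := r in
    [/\ 0 <= R1, 0 <= R2, 0 <= mu &
      forall eps : R, 0 < eps -> exists n0 : nat, forall n : nat, (n0 < n)%N ->
        exists c : CDIB_code A1 A2 n,
          [/\ n%:R^-1 * log2 (#|msg1 c|%:R : R) <= R1 + eps,
              n%:R^-1 * log2 (#|msg2 c|%:R : R) <= R2 + eps &
              mu - eps <=
              n%:R^-1 * mutual_info (iid_pmf p (n := n))
                          (map_seq (@src_Y A1 A2 B) (n := n))
                          [% @code_I1 A1 A2 B n c, @code_J1 A1 A2 B n c]]]].

(* The coordinates of a joint pmf q(x1, x2, y, v1, v2). *)
Section Coordinates.
Context {A1 A2 B C1 C2 : Type}.
Implicit Type w : A1 * A2 * B * C1 * C2.
Definition rv_X1 w : A1 := w.1.1.1.1.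
Definition rv_X2 w : A2 := w.1.1.1.2.
Definition rv_Y w : B := w.1.1.2.
Definition rv_V1 w : C1 := w.1.2.
Definition rv_V2 w : C2 := w.2.
End Coordinates.

Definition extends_source (R : realType) (A1 A2 B C1 C2 : finType)
    (p : A1 * A2 * B -> R) (q : A1 * A2 * B * C1 * C2 -> R) : Prop :=
  is_pmf q /\ forall s, law q [% rv_X1, rv_X2, rv_Y] s = p s.

Definition rate_constraints (R : realType) (A1 A2 B C1 C2 : finType)
    (q : A1 * A2 * B * C1 * C2 -> R) (R1 R2 mu : R) : Prop :=
  [/\ R1 >= mutual_info q rv_X1 rv_V1,
      R2 >= cond_mutual_info q rv_X2 rv_V2 rv_V1 &
      mu <= mutual_info q rv_Y [% rv_V1, rv_V2]].

Definition R_CDIB_hat (R : realType) (A1 A2 B : finType)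
    (p : A1 * A2 * B -> R) : set (R * R * R) :=
  [set r : R * R * R | let: (R1, R2, mu) := r in
    [/\ 0 <= R1, 0 <= R2, 0 <= mu &
      exists (C1 C2 : finType) (q : A1 * A2 * B * C1 * C2 -> R),
        [/\ extends_source p q,
            rate_constraints q R1 R2 mu,
            markov_chain q rv_V1 rv_X1 [% rv_X2, rv_Y] &
            markov_chain q rv_V2 [% rv_V1, rv_X1, rv_X2] rv_Y]]].

Definition R_CDIB_tilde (R : realType) (A1 A2 B : finType)
    (p : A1 * A2 * B -> R) : set (R * R * R) :=
  [set r : R * R * R | let: (R1, R2, mu) := r in
    [/\ 0 <= R1, 0 <= R2, 0 <= mu &
      exists (C1 C2 : finType) (q : A1 * A2 * B * C1 * C2 -> R),
        [/\ extends_source p q,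
            rate_constraints q R1 R2 mu,
            markov_chain q rv_V1 rv_X1 [% rv_X2, rv_Y] &
            markov_chain q rv_V2 [% rv_V1, rv_X2] [% rv_X1, rv_Y]]]].

(* Main.v *)
(** The hat and tilde regions agree because, when X1 - X2 - Y, replacing
    p(v2 | v1, x1, x2) by p(v2 | v1, x2) changes the law of neither (V1, X2, V2)
    nor (Y, V1, V2): Y depends on the other variables through X2 only.

    Converse. With S the source triple, take V1_i = (I1, S^(i-1)) and V2_i = J1.
    The three information quantities then telescope, and time sharing gives a
    point of the hat region for the rates (R1 + eps, R2 + eps, mu - eps). The hat
    region is closed, because the auxiliary alphabets can be bounded by conic
    Caratheodory and entropy is continuous.

    Achievability. V1^n is covered by a random codebook and, for each of its
    words, V2^n is covered conditionally on it. A covering code can be made to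
    avoid any set of small probability, so encoder 1 also avoids the pairs
    (x1, v1) for which encoder 2 is likely to fail, and encoder 2 those for which
    the density of (v1, v2) with respect to Y is likely to be too small. Then
    I(Y^n; I1 J1) is bounded below by Gibbs' inequality, and the probabilities of
    deviation of the information densities decay exponentially. *)
Require Import Defs.
From mathcomp Require Import all_boot all_order all_algebra.
From mathcomp Require Import all_classical all_reals all_analysis.
From mathcomp Require Import ring lra zify.

Set Implicit Arguments.
Unset Strict Implicit.
Unset Printing Implicit Defensive.

Import Order.TTheory GRing.Theory Num.Theory.
Import numFieldNormedType.Exports.

Local Open Scope ring_scope.

(** The auxiliary alphabets given by the converse grow with the block length, so limits of joint
    laws make sense only once these alphabets are bounded. In achievability the figure of merit is a
    mutual information and not an error probability: if the density at the chosen codewords is at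
    least t outside an event of probability [err], the information is at least (1 - err) log t - 1.
    The lost bit disappears after division by n, and [err] only has to be small compared with eps
    over the target information. The thresholds [eta] of the two encoders thus stay fixed as n
    grows, and the factors [eta^-1] that Markov's inequality brings in are harmless. The regions are
    linked by a third description, a pair of kernels p(v1 | x1) and p(v2 | v1, x2): tilde lies in
    hat, hat in kernel, kernel in tilde, and codes are built from kernels. *)

Section Logarithm.
Context {R : realType}.
Implicit Types x y : R.

Lemma ln2_gt0 : 0 < ln 2 :> R.
Proof. by rewrite ln_gt0 // ltr1n. Qed.

Lemma log2M x y : 0 < x -> 0 < y -> log2 (x * y) = log2 x + log2 y.
Proof. by move=> x0 y0; rewrite /log2 lnM ?posrE // mulrDl. Qed.

Lemma log2V x : 0 < x -> log2 x^-1 = - log2 x.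
Proof. by move=> x0; rewrite /log2 lnV ?posrE // mulNr. Qed.

Lemma log2_div x y : 0 < x -> 0 < y -> log2 (x / y) = log2 x - log2 y.
Proof. by move=> x0 y0; rewrite log2M ?invr_gt0 // log2V. Qed.

Lemma log2_le x y : 0 < x -> x <= y -> log2 x <= log2 y.
Proof.
move=> x0 xy; rewrite /log2 ler_pM2r ?invr_gt0 ?ln2_gt0 //.
by rewrite ler_ln ?posrE // (lt_le_trans x0).
Qed.

Lemma log2_powR x : log2 (2 `^ x) = x.
Proof. by rewrite /log2 ln_powR mulfK // gt_eqF // ln2_gt0. Qed.

(** This is ln u <= u - 1 at u = 1 / x. It is the analytic input of all the entropy inequalities:
    nonnegative conditional information, the cardinality bound and Gibbs' inequality. *)
Lemma log2_ge_1BV x : 0 < x -> (1 - x^-1) / ln 2 <= log2 x.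
Proof.
move=> x0; rewrite /log2 ler_pM2r ?invr_gt0 ?ln2_gt0 //.
have := @le_ln1Dx R (x^-1 - 1); rewrite addrCA subrr addr0 lnV ?posrE //.
rewrite ltrBrDr addrC subrr invr_gt0 => /(_ x0); lra.
Qed.

End Logarithm.

(** * Laws of random variables on a finite space *)

Section Laws.
Context {R : realType} {W : finType}.
Implicit Type p : W -> R.

Lemma lawE (A : finType) p (X : W -> A) a :
  law p X a = \sum_w p w * (X w == a)%:R.
Proof.
rewrite /law big_mkcond; apply: eq_bigr => w _.
by case: (X w == a); rewrite ?mulr1 ?mulr0.
Qed.

Lemma expect_law (A : finType) p (X : W -> A) (g : A -> R) :
  \sum_a law p X a * g a = \sum_w p w * g (X w).
Proof.
under eq_bigr => a _ do rewrite lawE mulr_suml.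
rewrite exchange_big; apply: eq_bigr => w _ /=.
rewrite (bigD1 (X w)) //= eqxx mulr1 big1 ?addr0 // => a Xa.
by rewrite eq_sym (negbTE Xa) mulr0 mul0r.
Qed.

Lemma law_ext (A : finType) p p' (X X' : W -> A) a :
  p =1 p' -> X =1 X' -> law p X a = law p' X' a.
Proof.
by move=> pp' XX'; rewrite !lawE; apply: eq_bigr => w _; rewrite pp' XX'.
Qed.

Lemma sum_law (A : finType) p (X : W -> A) : \sum_a law p X a = \sum_w p w.
Proof.
have := expect_law p X (fun=> 1).
by under eq_bigr do rewrite mulr1; under [in RHS]eq_bigr do rewrite mulr1.
Qed.

Lemma law_margr (A C : finType) p (X : W -> A) (Y : W -> C) a :
  \sum_c law p [% X, Y] (a, c) = law p X a.
Proof.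
rewrite lawE.
under eq_bigr => c _ do rewrite lawE.
rewrite exchange_big; apply: eq_bigr => w _ /=.
rewrite (bigD1 (Y w)) //= {1}/rv_pair xpair_eqE eqxx andbT big1 ?addr0 // => c Yc.
by rewrite /rv_pair xpair_eqE [Y w == _]eq_sym (negbTE Yc) andbF mulr0.
Qed.

Lemma law_margl (A C : finType) p (X : W -> A) (Y : W -> C) c :
  \sum_a law p [% X, Y] (a, c) = law p Y c.
Proof.
rewrite lawE.
under eq_bigr => a _ do rewrite lawE.
rewrite exchange_big; apply: eq_bigr => w _ /=.
rewrite (bigD1 (X w)) //= {1}/rv_pair xpair_eqE eqxx /= big1 ?addr0 // => a Xa.
by rewrite /rv_pair xpair_eqE [X w == _]eq_sym (negbTE Xa) mulr0.
Qed.

Lemma law_fun (A C : finType) p (X : W -> A) (Z : W -> C) (f : A -> C) c :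
  (forall w, Z w = f (X w)) -> law p Z c = \sum_(a | f a == c) law p X a.
Proof.
move=> Zf; rewrite big_mkcond /=.
transitivity (\sum_a law p X a * (f a == c)%:R); last first.
  by apply: eq_bigr => a _; case: (f a == c); rewrite ?mulr1 ?mulr0.
rewrite (expect_law p X (fun a => (f a == c)%:R)) lawE.
by apply: eq_bigr => w _; rewrite Zf.
Qed.

Section Nonneg.
Variable p : W -> R.
Hypothesis p0 : forall w, 0 <= p w.

Lemma law_ge0 (A : finType) (X : W -> A) a : 0 <= law p X a.
Proof. by apply: sumr_ge0. Qed.

Lemma law_gt0 (A : finType) (X : W -> A) w : p w != 0 -> 0 < law p X (X w).
Proof.
move=> pw; rewrite /law (bigD1 w) //= ltr_pwDl ?sumr_ge0 //.
by rewrite lt_def pw p0.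
Qed.

Lemma law_fun_le (A C : finType) (X : W -> A) (Z : W -> C) (f : A -> C) a :
  (forall w, Z w = f (X w)) -> law p X a <= law p Z (f a).
Proof.
move=> Zf; rewrite [leRHS](law_fun _ _ Zf) (bigD1 a) //= lerDl.
by apply: sumr_ge0 => *; apply: law_ge0.
Qed.

Lemma law_fun_eq0 (A C : finType) (X : W -> A) (Z : W -> C) (f : A -> C) a :
  (forall w, Z w = f (X w)) -> law p Z (f a) = 0 -> law p X a = 0.
Proof.
move=> Zf Z0; apply: le_anti; rewrite law_ge0 andbT -Z0.
exact: law_fun_le.
Qed.

End Nonneg.
End Laws.

Lemma law_comp {R : realType} (W A C : finType) (p : W -> R) (Z : W -> A) (X : A -> C) c :
  law (law p Z) X c = law p (X \o Z) c.
Proof. by rewrite [LHS]lawE [RHS]lawE; exact: (expect_law p Z (fun a => (X a == c)%:R)). Qed.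

(** * Entropy and Shannon's inequalities *)

Section Entropy.
Context {R : realType} {W : finType}.
Variable p : W -> R.
Hypothesis p0 : forall w, 0 <= p w.

Definition entropy (A : finType) (X : W -> A) : R :=
  - \sum_a law p X a * log2 (law p X a).

Lemma entropyE (A : finType) (X : W -> A) :
  entropy X = - \sum_w p w * log2 (law p X (X w)).
Proof. by congr (- _); exact: (expect_law p X (fun a => log2 (law p X a))). Qed.

(** Entropy sees only the partition into level sets, so reordering, regrouping or dropping
    determined components is checked on pairs of sample points. *)
Lemma entropy_congr (A C : finType) (X : W -> A) (Z : W -> C) :
  (forall w w', X w = X w' <-> Z w = Z w') -> entropy X = entropy Z.
Proof.
move=> XZ; rewrite !entropyE; congr (- _); apply: eq_bigr => w _.
congr (_ * log2 _); rewrite !lawE; apply: eq_bigr => w' _.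
by congr (_ * (nat_of_bool _)%:R); apply/eqP/eqP => /XZ.
Qed.

(** At a sample point of positive probability all marginals are positive, so in this form logarithms
    of quotients can be split freely. *)
Lemma mutual_infoE (A C : finType) (X : W -> A) (Y : W -> C) :
  mutual_info p X Y = \sum_w p w * log2 (law p [% X, Y] (X w, Y w) /
                         (law p X (X w) * law p Y (Y w))).
Proof.
rewrite /mutual_info pair_bigA /=.
rewrite -[RHS](expect_law p [% X, Y] (fun ab => log2 (law p [% X, Y] ab /
                         (law p X ab.1 * law p Y ab.2)))).
by apply: eq_bigr => -[a b] _.
Qed.

Lemma mutual_info_entropy (A C : finType) (X : W -> A) (Y : W -> C) :
  mutual_info p X Y = entropy X + entropy Y - entropy [% X, Y].
Proof.
rewrite mutual_infoE !entropyE opprK -opprD addrC -big_split -sumrB /=.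
apply: eq_bigr => w _; have [->|pw] := eqVneq (p w) 0; first by ring.
have X0 := law_gt0 p0 X pw; have Y0 := law_gt0 p0 Y pw.
have XY0 := law_gt0 p0 [% X, Y] pw.
by rewrite log2_div ?mulr_gt0 // log2M //; ring.
Qed.

Lemma cond_mutual_infoE (A C D : finType) (X : W -> A) (Y : W -> C)
    (Z : W -> D) :
  cond_mutual_info p X Y Z =
  \sum_w p w * log2 (law p [% X, Y, Z] (X w, Y w, Z w) * law p Z (Z w) /
         (law p [% X, Z] (X w, Z w) * law p [% Y, Z] (Y w, Z w))).
Proof.
rewrite /cond_mutual_info pair_bigA /= pair_bigA /=.
rewrite -[RHS](expect_law p [% X, Y, Z] (fun t => log2 (law p [% X, Y, Z] t *
   law p Z t.2 / (law p [% X, Z] (t.1.1, t.2) * law p [% Y, Z] (t.1.2, t.2))))).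
apply: eq_bigr => -[[a b] c] _ /=; rewrite /cond_law.
have [Z0|Z0] := eqVneq (law p Z c) 0.
  have -> : law p [% X, Y, Z] (a, b, c) = 0.
    by apply: (@law_fun_eq0 _ _ p p0 _ _ [% X, Y, Z] Z snd (a, b, c)).
  by rewrite !mul0r.
(* Division by 0 gives 0, so a vanishing denominator leaves the same [log2 0] on both sides. *)
have [XZ0|XZ0] := eqVneq (law p [% X, Z] (a, c)) 0.
  by rewrite XZ0 !mul0r !invr0 !mulr0.
have [YZ0|YZ0] := eqVneq (law p [% Y, Z] (b, c)) 0.
  by rewrite YZ0 !mul0r !mulr0 !invr0 !mulr0.
congr (_ * log2 _); field.
by rewrite Z0 XZ0 YZ0.
Qed.

Lemma cond_mutual_info_entropy (A C D : finType) (X : W -> A) (Y : W -> C)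
    (Z : W -> D) :
  cond_mutual_info p X Y Z = entropy [% X, Z] + entropy [% Y, Z]
    - entropy [% X, Y, Z] - entropy Z.
Proof.
rewrite cond_mutual_infoE !entropyE !opprK -opprD -addrA addrC -!big_split -sumrB /=.
apply: eq_bigr => w _.
have [->|pw] := eqVneq (p w) 0; first by ring.
have Z0 := law_gt0 p0 Z pw.
have XZ0 := law_gt0 p0 [% X, Z] pw; have YZ0 := law_gt0 p0 [% Y, Z] pw.
have XYZ0 := law_gt0 p0 [% X, Y, Z] pw.
by rewrite log2_div ?mulr_gt0 // !log2M //=; ring.
Qed.

(** With [r] the ratio of the conditionally independent law to the true one, - log2 r >= (1 - r) /
    ln 2 pointwise, and the mean of [r] is at most 1 because it sums the former law over the support
    of the latter. *)
Lemma cond_mutual_info_ge0 (A C D : finType) (X : W -> A) (Y : W -> C)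
    (Z : W -> D) : 0 <= cond_mutual_info p X Y Z.
Proof.
rewrite cond_mutual_infoE.
pose r t := law p [% X, Z] (t.1.1, t.2) * law p [% Y, Z] (t.1.2, t.2) /
   (law p [% X, Y, Z] t * law p Z t.2).
apply: (@le_trans _ _ (\sum_w p w * ((1 - r ([% X, Y, Z] w)) / ln 2))); last first.
  apply: ler_sum => w _; have [->|pw] := eqVneq (p w) 0; first by rewrite !mul0r.
  apply: ler_wpM2l => //.
  have Z0 := law_gt0 p0 Z pw.
  have XZ0 := law_gt0 p0 [% X, Z] pw; have YZ0 := law_gt0 p0 [% Y, Z] pw.
  have XYZ0 := law_gt0 p0 [% X, Y, Z] pw.
  have := @log2_ge_1BV R (r ([% X, Y, Z] w))^-1.
  by rewrite invrK /r invf_div; apply; rewrite divr_gt0 // mulr_gt0.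
under eq_bigr => w _ do rewrite mulrA mulrBr mulr1.
rewrite -mulr_suml divr_ge0 ?(ltW ln2_gt0) // sumrB subr_ge0.
rewrite -(expect_law p [% X, Y, Z] r) /r.
apply: (@le_trans _ _ (\sum_(t : A * C * D) law p [% X, Z] (t.1.1, t.2) *
   law p [% Y, Z] (t.1.2, t.2) / law p Z t.2)).
  apply: ler_sum => -[[a b] c] _ /=; set u := law p [% X, Y, Z] _.
  have [->|u0] := eqVneq u 0; first by rewrite mul0r !(mulr_ge0,invr_ge0,law_ge0).
  by rewrite invfM mulrCA [u * _]mulrA mulfV // mul1r.
rewrite -(pair_bigA _ (fun s c => law p [% X, Z] (s.1, c) *
   law p [% Y, Z] (s.2, c) / law p Z c)) /= exchange_big /=.
rewrite -(sum_law p Z); apply: ler_sum => c _.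
rewrite -mulr_suml -(pair_bigA _ (fun a b => law p [% X, Z] (a, c) *
   law p [% Y, Z] (b, c))) /=.
under eq_bigr => a _ do rewrite -mulr_sumr law_margl.
rewrite -mulr_suml law_margl.
have [->|Z0] := eqVneq (law p Z c) 0; first by rewrite !mul0r.
by rewrite mulfK.
Qed.

Lemma entropy_submod (A C D : finType) (X : W -> A) (Y : W -> C) (Z : W -> D) :
  entropy [% X, Y, Z] + entropy Z <= entropy [% X, Z] + entropy [% Y, Z].
Proof.
by have := cond_mutual_info_ge0 X Y Z; rewrite cond_mutual_info_entropy; lra.
Qed.

(** Submodularity in the case where [Z] is a function of [Y]: this is H(X | Y) <= H(X | Z). *)
Lemma cond_entropy_le (A C D : finType) (X : W -> A) (Y : W -> C) (Z : W -> D) :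
  (forall w w', Y w = Y w' -> Z w = Z w') ->
  entropy [% X, Y] - entropy Y <= entropy [% X, Z] - entropy Z.
Proof.
move=> YZ; have := entropy_submod X Y Z.
rewrite (@entropy_congr _ _ [% X, Y, Z] [% X, Y]) => [|w w']; last first.
  by rewrite /rv_pair; split=> [[-> -> _]|[-> Yw]] //; rewrite Yw (YZ _ _ Yw).
rewrite (@entropy_congr _ _ [% Y, Z] Y) => [|w w']; first lra.
by rewrite /rv_pair; split=> [[->]|Yw] //; rewrite Yw (YZ _ _ Yw).
Qed.

Lemma mutual_info_sub (A C D : finType) (X : W -> A) (Y : W -> C) (Z : W -> D) :
  (forall w w', X w = X w' -> Z w = Z w') ->
  mutual_info p Z Y <= mutual_info p X Y.
Proof.
move=> XZ; rewrite !mutual_info_entropy; have := cond_entropy_le Y XZ.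
rewrite (@entropy_congr _ _ [% Y, X] [% X, Y]); last first.
  by move=> w w'; rewrite /rv_pair; split=> -[-> ->].
rewrite (@entropy_congr _ _ [% Y, Z] [% Z, Y]); last first.
  by move=> w w'; rewrite /rv_pair; split=> -[-> ->].
lra.
Qed.

Lemma cond_mutual_info_sub (A C D E : finType) (X : W -> A) (Y : W -> C)
    (Z : W -> D) (T : W -> E) :
  (forall w w', X w = X w' -> T w = T w') ->
  cond_mutual_info p T Y Z <= cond_mutual_info p X Y Z.
Proof.
move=> XT; rewrite !cond_mutual_info_entropy.
have := @cond_entropy_le _ _ _ Y [% X, Z] [% T, Z].
rewrite (@entropy_congr _ _ [% Y, [% X, Z]] [% X, Y, Z]); last first.
  by move=> w w'; rewrite /rv_pair; split=> -[-> -> ->].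
rewrite (@entropy_congr _ _ [% Y, [% T, Z]] [% T, Y, Z]); last first.
  by move=> w w'; rewrite /rv_pair; split=> -[-> -> ->].
move=> h; suff : forall w w', [% X, Z] w = [% X, Z] w' -> [% T, Z] w = [% T, Z] w'.
  by move=> /h; lra.
by move=> w w'; rewrite /rv_pair => -[/XT -> ->].
Qed.

Hypothesis p1 : \sum_w p w = 1.

Lemma entropy_const (A : finType) (X : W -> A) a :
  (forall w, X w = a) -> entropy X = 0.
Proof.
move=> Xa; rewrite entropyE big1 ?oppr0 // => w _; rewrite lawE.
under eq_bigr do rewrite !Xa eqxx mulr1.
by rewrite p1 /log2 ln1 mul0r mulr0.
Qed.

(** Nonnegativity of the divergence from the uniform law, again by the tangent bound. *)
Lemma entropy_le_card (A : finType) (X : W -> A) :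
  entropy X <= log2 #|A|%:R.
Proof.
have A0 : 0 < #|A|%:R :> R.
  rewrite ltr0n; apply/card_gt0P.
  case: (pickP (@predT W)) => [w _|W0]; first by exists (X w).
  by move: p1 => /eqP; rewrite big_pred0 // eq_sym oner_eq0.
rewrite -subr_ge0 entropyE opprK.
have -> : log2 #|A|%:R = \sum_w p w * log2 #|A|%:R :> R.
  by rewrite -mulr_suml p1 mul1r.
rewrite -big_split /=.
apply: (@le_trans _ _ (\sum_w p w * ((1 - (law p X (X w) * #|A|%:R)^-1) / ln 2))).
  under eq_bigr => w _ do rewrite mulrA mulrBr mulr1.
  rewrite -mulr_suml divr_ge0 ?(ltW ln2_gt0) // sumrB subr_ge0 p1.
  rewrite -(expect_law p X (fun a => (law p X a * #|A|%:R)^-1)).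
  apply: (@le_trans _ _ (\sum_(a : A) #|A|%:R^-1)).
    apply: ler_sum => a _; rewrite invfM mulrA.
    have [->|u0] := eqVneq (law p X a) 0; first by rewrite !mul0r invr_ge0 ltW.
    by rewrite mulfV // mul1r.
  by rewrite sumr_const -[_ *+ _]mulr_natr mulVf // gt_eqF.
apply: ler_sum => w _; have [->|pw] := eqVneq (p w) 0; first by rewrite !mul0r addr0.
have X0 := law_gt0 p0 X pw.
rewrite -mulrDr ler_wpM2l // [leRHS]addrC -log2M //.
by rewrite log2_ge_1BV // mulr_gt0.
Qed.

End Entropy.

(** * Equality of the two single-letter regions *)

Section LawKernel.
Context {R : realType}.

Lemma sum_prod (T C : finType) (f : T * C -> R) :
  \sum_w f w = \sum_t \sum_c f (t, c).
Proof. by rewrite pair_bigA; apply: eq_bigr => -[]. Qed.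

Lemma law_id (W : finType) (p : W -> R) w : law p id w = p w.
Proof. by rewrite /law big_pred1_eq. Qed.

Lemma eq_law (W A C : finType) (p : W -> R) (X : W -> A) (Y : W -> C) a c :
  (forall w, (X w == a) = (Y w == c)) -> law p X a = law p Y c.
Proof. by move=> E; rewrite /law; apply: eq_bigl. Qed.

Lemma mutual_info_ext (W W' A C : finType) (p : W -> R) (p' : W' -> R)
    (X : W -> A) (Y : W -> C) (X' : W' -> A) (Y' : W' -> C) :
  (forall a c, law p [% X, Y] (a, c) = law p' [% X', Y'] (a, c)) ->
  mutual_info p X Y = mutual_info p' X' Y'.
Proof.
move=> E; apply: eq_bigr => a _; apply: eq_bigr => c _.
have -> : law p X a = law p' X' a.
  by rewrite -(law_margr p X Y) -(law_margr p' X' Y'); apply: eq_bigr.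
have -> : law p Y c = law p' Y' c.
  by rewrite -(law_margl p X Y) -(law_margl p' X' Y'); apply: eq_bigr.
by rewrite E.
Qed.

Lemma cond_mutual_info_ext (W W' A C D : finType) (p : W -> R) (p' : W' -> R)
    (X : W -> A) (Y : W -> C) (Z : W -> D)
    (X' : W' -> A) (Y' : W' -> C) (Z' : W' -> D) :
  (forall a b c, law p [% X, Y, Z] (a, b, c) = law p' [% X', Y', Z'] (a, b, c)) ->
  cond_mutual_info p X Y Z = cond_mutual_info p' X' Y' Z'.
Proof.
move=> E; apply: eq_bigr => a _; apply: eq_bigr => b _; apply: eq_bigr => c _.
have EXZ : law p [% X, Z] (a, c) = law p' [% X', Z'] (a, c).
  rewrite (law_fun _ (X := [% X, Y, Z]) (f := fun t => (t.1.1, t.2))) //.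
  rewrite (law_fun _ (X := [% X', Y', Z']) (f := fun t => (t.1.1, t.2))) //.
  by apply: eq_bigr => -[[? ?] ?] _.
have EYZ : law p [% Y, Z] (b, c) = law p' [% Y', Z'] (b, c).
  rewrite (law_fun _ (X := [% X, Y, Z]) (f := fun t => (t.1.2, t.2))) //.
  rewrite (law_fun _ (X := [% X', Y', Z']) (f := fun t => (t.1.2, t.2))) //.
  by apply: eq_bigr => -[[? ?] ?] _.
have EZ : law p Z c = law p' Z' c.
  rewrite (law_fun _ (X := [% X, Y, Z]) (f := snd)) //.
  rewrite (law_fun _ (X := [% X', Y', Z']) (f := snd)) //.
  by apply: eq_bigr => -[[? ?] ?] _.
by rewrite /cond_law E EXZ EYZ EZ.
Qed.

(** The cross-multiplied form is polynomial in the law, so it passes to limits and behaves well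
    under rescaling; where the conditional law is undefined both sides vanish. *)
Lemma markov_chainE (W A C D : finType) (p : W -> R) (X : W -> A) (Y : W -> C)
    (Z : W -> D) : (forall w, 0 <= p w) ->
  markov_chain p X Y Z <->
  forall a b c, law p [% X, [% Y, Z]] (a, (b, c)) * law p Y b =
                law p [% X, Y] (a, b) * law p [% Y, Z] (b, c).
Proof.
move=> p0; rewrite /markov_chain /cond_law; split=> H a b c.
  have [YZ0|YZ0] := eqVneq (law p [% Y, Z] (b, c)) 0.
    have -> : law p [% X, [% Y, Z]] (a, (b, c)) = 0.
      by apply: (@law_fun_eq0 _ _ p p0 _ _ _ [% Y, Z] snd (a, (b, c))).
    by rewrite YZ0 mul0r mulr0.
  have Y0 : law p Y b != 0.
    apply: contraNneq YZ0 => Y0; apply/eqP.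
    exact: (@law_fun_eq0 _ _ p p0 _ _ _ Y fst (b, c)).
  by have /eqP := H a b c YZ0; rewrite eqr_div // => /eqP.
move=> YZ0.
have Y0 : law p Y b != 0.
  apply: contraNneq YZ0 => Y0; apply/eqP.
  exact: (@law_fun_eq0 _ _ p p0 _ _ _ Y fst (b, c)).
by apply/eqP; rewrite eqr_div // H.
Qed.

Definition is_kernel (A C : finType) (k : A -> C -> R) := forall a, is_pmf (k a).

(** A kernel factors out of the law of any observation [F] that determines its input. *)
Lemma law_kernel (T A D C : finType) (q : T * C -> R) (m : T -> R)
    (F : T -> A) (g : A -> D) (k : D -> C -> R) a c :
  (forall t c, q (t, c) = m t * k (g (F t)) c) ->
  law q [% F \o fst, snd] (a, c) = law m F a * k (g a) c.
Proof.
move=> qE; rewrite !lawE mulr_suml.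
rewrite sum_prod.
apply: eq_bigr => t _; rewrite (bigD1 c) //= big1 ?addr0 => [|c' cc'].
  rewrite qE /rv_pair /= xpair_eqE eqxx andbT.
  by have [->|] := eqVneq (F t) a; [ring|rewrite !(mulr0,mul0r)].
by rewrite /rv_pair /= xpair_eqE (negbTE cc') andbF mulr0.
Qed.

Lemma law_kernel_fst (T A D C : finType) (q : T * C -> R) (m : T -> R)
    (F : T -> A) (g : T -> D) (k : D -> C -> R) a :
  is_kernel k -> (forall t c, q (t, c) = m t * k (g t) c) ->
  law q (fun w => F w.1) a = law m F a.
Proof.
move=> kk qE; rewrite !lawE.
rewrite sum_prod.
apply: eq_bigr => t _ /=; rewrite -mulr_suml; congr (_ * _).
by under eq_bigr do rewrite qE; rewrite -mulr_sumr (kk _).2 mulr1.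
Qed.

Lemma pmf_kernel (T D C : finType) (q : T * C -> R) (m : T -> R)
    (g : T -> D) (k : D -> C -> R) :
  is_kernel k -> is_pmf m -> (forall t c, q (t, c) = m t * k (g t) c) ->
  is_pmf q.
Proof.
move=> kk [m0 m1] qE; split=> [[t c]|]; first by rewrite qE mulr_ge0 // (kk _).1.
rewrite -m1 sum_prod; apply: eq_bigr => t _.
by under eq_bigr do rewrite qE; rewrite -mulr_sumr (kk _).2 mulr1.
Qed.

(* The conditional law of [Y] given [X], completed by the law of [Y] outside of
   the support of [X] so as to be a stochastic kernel. *)
Definition kernel_of (W A C : finType) (p : W -> R) (X : W -> A) (Y : W -> C)
    (a : A) (c : C) : R :=
  if law p X a == 0 then law p Y c else law p [% X, Y] (a, c) / law p X a.

Section KernelOf.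
Context {W A C : finType}.
Variables (p : W -> R) (X : W -> A) (Y : W -> C).
Hypothesis hp : is_pmf p.

Lemma kernel_ofP : is_kernel (kernel_of p X Y).
Proof.
move=> a; rewrite /kernel_of; have [_|X0] := eqVneq.
  by split=> [c|]; [exact: (law_ge0 hp.1)|rewrite sum_law hp.2].
split=> [c|]; first by rewrite divr_ge0 // (law_ge0 hp.1).
by rewrite -mulr_suml law_margr mulfV.
Qed.

Lemma kernel_ofE a c : law p X a * kernel_of p X Y a c = law p [% X, Y] (a, c).
Proof.
rewrite /kernel_of; have [X0|X0] := eqVneq; last by rewrite mulrC divfK.
by rewrite X0 mul0r (@law_fun_eq0 _ _ p hp.1 _ _ _ X fst (a, c)).
Qed.

End KernelOf.
End LawKernel.

(** Identifies two events that fix the same coordinates in another order or grouping, by cases on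
    each equality test. *)
Ltac law_perm :=
  apply: eq_law => -[[[[? ?] ?] ?] ?]; rewrite /rv_pair /id /= ?xpair_eqE;
  by do ![case: (_ == _) => //=].

(** * The regions in terms of a pair of kernels *)

Section KernelForm.
Context {R : realType} {A1 A2 B : finType}.
Variable p : A1 * A2 * B -> R.
Hypothesis hp : is_pmf p.

(** Free parametrisation of the tilde structure: both of its Markov chains hold by construction. *)
Definition joint_of (C1 C2 : finType) (w1 : A1 -> C1 -> R)
    (w2 : C1 * A2 -> C2 -> R) (w : A1 * A2 * B * C1 * C2) : R :=
  p w.1.1 * w1 w.1.1.1.1 w.1.2 * w2 (w.1.2, w.1.1.1.2) w.2.

Definition single_letter_hat (r : R * R * R) : Prop :=
  let: (R1, R2, mu) := r in
  exists (C1 C2 : finType) (q : A1 * A2 * B * C1 * C2 -> R),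
    [/\ extends_source p q, rate_constraints q R1 R2 mu,
        markov_chain q rv_V1 rv_X1 [% rv_X2, rv_Y] &
        markov_chain q rv_V2 [% rv_V1, rv_X1, rv_X2] rv_Y].

Definition single_letter_tilde (r : R * R * R) : Prop :=
  let: (R1, R2, mu) := r in
  exists (C1 C2 : finType) (q : A1 * A2 * B * C1 * C2 -> R),
    [/\ extends_source p q, rate_constraints q R1 R2 mu,
        markov_chain q rv_V1 rv_X1 [% rv_X2, rv_Y] &
        markov_chain q rv_V2 [% rv_V1, rv_X2] [% rv_X1, rv_Y]].

Definition single_letter_kernel (r : R * R * R) : Prop :=
  let: (R1, R2, mu) := r in
  exists (C1 C2 : finType) (w1 : A1 -> C1 -> R) (w2 : C1 * A2 -> C2 -> R),
    [/\ is_kernel w1, is_kernel w2 & rate_constraints (joint_of w1 w2) R1 R2 mu].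

Section JointOf.
Context {C1 C2 : finType}.
Variables (w1 : A1 -> C1 -> R) (w2 : C1 * A2 -> C2 -> R).
Hypotheses (hw1 : is_kernel w1) (hw2 : is_kernel w2).
Let q := joint_of w1 w2.
Let m (t : A1 * A2 * B * C1) : R := p t.1 * w1 t.1.1.1 t.2.

Lemma joint_of_pmf : is_pmf q.
Proof.
apply: (pmf_kernel (m := m) (g := fun t => (t.2, t.1.1.2)) hw2) => //.
by apply: (pmf_kernel (m := p) (g := fun s => s.1.1) hw1).
Qed.

Lemma joint_of_law_source (A : finType) (F : A1 * A2 * B -> A) a :
  law q (fun w => F w.1.1) a = law p F a.
Proof.
transitivity (law m (fun t => F t.1) a).
  by apply: (@law_kernel_fst _ _ _ _ _ _ _ (fun t => F t.1) (fun t => (t.2, t.1.1.2)) w2).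
by apply: (@law_kernel_fst _ _ _ _ _ _ _ F (fun s => s.1.1) w1).
Qed.

Lemma joint_of_law_V1 (A : finType) (F : A1 * A2 * B -> A) (g : A -> A1) a v1 :
  (forall s, s.1.1 = g (F s)) ->
  law q [% fun w => F w.1.1, rv_V1] (a, v1) = law p F a * w1 (g a) v1.
Proof.
move=> gF; transitivity (law m [% F \o fst, snd] (a, v1)).
  by apply: (@law_kernel_fst _ _ _ _ _ _ _ [% F \o fst, snd] (fun t => (t.2, t.1.1.2)) w2).
by apply: (@law_kernel _ _ _ _ _ m p F g w1) => t c; rewrite -gF.
Qed.

Lemma joint_of_law_V2 (A : finType) (F : A1 * A2 * B * C1 -> A)
    (g : A -> C1 * A2) a v2 :
  (forall t, (t.2, t.1.1.2) = g (F t)) ->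
  law q [% fun w => F w.1, rv_V2] (a, v2) = law m F a * w2 (g a) v2.
Proof.
by move=> gF; apply: (@law_kernel _ _ _ _ _ q m F g w2) => t c; rewrite -gF.
Qed.

Lemma joint_of_law_fst (A : finType) (F : A1 * A2 * B * C1 -> A) a :
  law q (fun w => F w.1) a = law m F a.
Proof.
by apply: (@law_kernel_fst _ _ _ _ _ _ _ F (fun t => (t.2, t.1.1.2)) w2).
Qed.

End JointOf.

Lemma kernel_tilde r : single_letter_kernel r -> single_letter_tilde r.
Proof.
case: r => [[R1 R2] mu] [C1 [C2 [w1 [w2 [hw1 hw2 rates]]]]].
have hq := joint_of_pmf hw1 hw2.
exists C1, C2, (joint_of w1 w2); split=> //.
- split=> // s; rewrite -[RHS](law_id p).
  rewrite -(joint_of_law_source hw1 hw2); apply: law_ext => // w.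
  by case: w => [[[[? ?] ?] ?] ?].
- apply/(markov_chainE _ _ _ hq.1) => v1 x1 -[x2 y].
  have -> : law (joint_of w1 w2) rv_X1 x1 = law p (fun s => s.1.1) x1.
    exact: (joint_of_law_source hw1 hw2).
  have -> : law (joint_of w1 w2) [% rv_X1, [% rv_X2, rv_Y]] (x1, (x2, y)) =
            law p (fun s => (s.1.1, (s.1.2, s.2))) (x1, (x2, y)).
    exact: (joint_of_law_source hw1 hw2).
  have -> : law (joint_of w1 w2) [% rv_V1, rv_X1] (v1, x1) =
            law p (fun s => s.1.1) x1 * w1 x1 v1.
    rewrite -(@joint_of_law_V1 _ _ _ _ hw2 _ _ id) //; law_perm.
  have -> : law (joint_of w1 w2) [% rv_V1, [% rv_X1, [% rv_X2, rv_Y]]]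
      (v1, (x1, (x2, y))) =
      law p (fun s => (s.1.1, (s.1.2, s.2))) (x1, (x2, y)) * w1 x1 v1.
    rewrite -(@joint_of_law_V1 _ _ _ _ hw2 _ _ fst) //; law_perm.
  ring.
- apply/(markov_chainE _ _ _ hq.1) => v2 -[v1 x2] [x1 y].
  have -> : law (joint_of w1 w2) [% rv_V2, [% [% rv_V1, rv_X2], [% rv_X1, rv_Y]]]
      (v2, ((v1, x2), (x1, y))) = law (joint_of w1 w2)
      [% fun w => (w.1.2, w.1.1.1.2, (w.1.1.1.1, w.1.1.2)), rv_V2]
      (v1, x2, (x1, y), v2) by law_perm.
  have -> : law (joint_of w1 w2) [% rv_V2, [% rv_V1, rv_X2]] (v2, (v1, x2)) =
      law (joint_of w1 w2) [% fun w => (w.1.2, w.1.1.1.2), rv_V2]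
      (v1, x2, v2) by law_perm.
  rewrite (@joint_of_law_V2 _ _ w1 w2 _
    (fun t => (t.2, t.1.1.2, (t.1.1.1, t.1.2))) fst) //.
  rewrite (@joint_of_law_V2 _ _ w1 w2 _ (fun t => (t.2, t.1.1.2)) id) //.
  rewrite (@joint_of_law_fst _ _ w1 w2 hw2 _ (fun t => (t.2, t.1.1.2))).
  rewrite (@joint_of_law_fst _ _ w1 w2 hw2 _
    (fun t => (t.2, t.1.1.2, (t.1.1.1, t.1.2)))).
  rewrite /=; ring.
Qed.

Lemma tilde_hat r : single_letter_tilde r -> single_letter_hat r.
Proof.
case: r => [[R1 R2] mu] [C1 [C2 [q [[hq qp] rates V1c V2c]]]].
exists C1, C2, q; split=> //.
move/(markov_chainE _ _ _ hq.1) in V2c.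
apply/(markov_chainE _ _ _ hq.1) => v2 [[v1 x1] x2] y.
have -> : law q [% rv_V2, [% [% rv_V1, rv_X1, rv_X2], rv_Y]] (v2, (v1, x1, x2, y))
  = law q [% rv_V2, [% [% rv_V1, rv_X2], [% rv_X1, rv_Y]]] (v2, (v1, x2, (x1, y))).
  by law_perm.
have -> : law q [% [% rv_V1, rv_X1, rv_X2], rv_Y] (v1, x1, x2, y)
  = law q [% [% rv_V1, rv_X2], [% rv_X1, rv_Y]] (v1, x2, (x1, y)).
  by law_perm.
(* Summing the chain over y shows that V2 is also independent of X1 alone given (V1, X2). *)
have V2x : law q [% rv_V2, [% rv_V1, rv_X1, rv_X2]] (v2, (v1, x1, x2)) *
    law q [% rv_V1, rv_X2] (v1, x2) = law q [% rv_V2, [% rv_V1, rv_X2]]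
      (v2, (v1, x2)) * law q [% rv_V1, rv_X1, rv_X2] (v1, x1, x2).
  transitivity ((\sum_y' law q [% rv_V2, [% [% rv_V1, rv_X2], [% rv_X1, rv_Y]]]
      (v2, (v1, x2, (x1, y')))) * law q [% rv_V1, rv_X2] (v1, x2)).
    rewrite -(law_margr _ _ rv_Y); congr (_ * _); apply: eq_bigr => y' _.
    by law_perm.
  rewrite mulr_suml; under eq_bigr do rewrite V2c.
  rewrite -mulr_sumr -(law_margr _ [% rv_V1, rv_X1, rv_X2] rv_Y).
  by congr (_ * _); apply: eq_bigr => y' _; law_perm.
have [V0|V0] := eqVneq (law q [% rv_V1, rv_X2] (v1, x2)) 0.
  have -> : law q [% rv_V2, [% [% rv_V1, rv_X2], [% rv_X1, rv_Y]]]
      (v2, (v1, x2, (x1, y))) = 0.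
    by apply: (@law_fun_eq0 _ _ q hq.1 _ _ _ [% rv_V1, rv_X2] (fun t => t.2.1)
      (v2, (v1, x2, (x1, y)))).
  have -> : law q [% [% rv_V1, rv_X2], [% rv_X1, rv_Y]] (v1, x2, (x1, y)) = 0.
    by apply: (@law_fun_eq0 _ _ q hq.1 _ _ _ [% rv_V1, rv_X2] fst
      (v1, x2, (x1, y))).
  by rewrite mul0r mulr0.
apply: (mulIf V0).
by rewrite mulrAC V2c mulrAC [RHS]mulrAC V2x.
Qed.


Hypothesis hM : markov_chain p (@src_X1 A1 A2 B) (@src_X2 A1 A2 B)
  (@src_Y A1 A2 B).

Let W := kernel_of p (@src_X2 A1 A2 B) (@src_Y A1 A2 B).
Let p12 := law p (fun s => s.1).

(** The form in which X1 - X2 - Y is used from here on. Where X2 has probability 0 both sides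
    vanish, whatever the completed kernel is there. *)
Lemma source_factor s : p s = p12 s.1 * W s.1.2 s.2.
Proof.
have M := proj1 (markov_chainE _ _ _ hp.1) hM.
have [X0|X0] := eqVneq (law p (@src_X2 A1 A2 B) s.1.2) 0.
  rewrite /p12 -(law_id p) (@law_fun_eq0 _ _ p hp.1 _ _ id (@src_X2 _ _ _)
    (fun s => s.1.2)) //.
  rewrite (@law_fun_eq0 _ _ p hp.1 _ _ _ (@src_X2 _ _ _) snd) //.
  by rewrite mul0r.
have -> : p s = law p [% @src_X1 A1 A2 B, [% @src_X2 A1 A2 B, @src_Y A1 A2 B]]
    (s.1.1, (s.1.2, s.2)).
  rewrite -[LHS](law_id p); apply: eq_law => w.
  by rewrite [s]surjective_pairing [s.1]surjective_pairing; case: w => [[? ?] ?];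
    rewrite /rv_pair !xpair_eqE /= andbA.
apply: (mulIf X0); rewrite mulrAC -mulrA kernel_ofE // M; congr (_ * _).
Qed.

Lemma hat_kernel r : single_letter_hat r -> single_letter_kernel r.
Proof.
case: r => [[R1 R2] mu] [C1 [C2 [q [[hq qp] [r1 r2 r3] V1c V2c]]]].
move/(markov_chainE _ _ _ hq.1) in V1c.
move/(markov_chainE _ _ _ hq.1) in V2c.
pose w1 := kernel_of q rv_X1 rv_V1.
pose w2 := kernel_of q [% rv_V1, rv_X2] rv_V2.
have hw1 : is_kernel w1 by apply: kernel_ofP.
have hw2 : is_kernel w2 by apply: kernel_ofP.
exists C1, C2, w1, w2; split=> //.
have qs (A : finType) (F : A1 * A2 * B -> A) a :
    law q (fun w => F w.1.1) a = law p F a.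
  by rewrite -[LHS](law_comp q (fun w => w.1.1) F); apply: law_ext.
have m_law (t : A1 * A2 * B * C1) : law q fst t = p t.1 * w1 t.1.1.1 t.2.
  case: t => [[[x1 x2] y] v1] /=.
  have := V1c v1 x1 (x2, y).
  have -> : law q [% rv_V1, [% rv_X1, [% rv_X2, rv_Y]]] (v1, (x1, (x2, y))) =
      law q fst (x1, x2, y, v1) by law_perm.
  have -> : law q [% rv_X1, [% rv_X2, rv_Y]] (x1, (x2, y)) = p (x1, x2, y).
    by rewrite -qp; law_perm.
  have -> : law q [% rv_V1, rv_X1] (v1, x1) = law q [% rv_X1, rv_V1] (x1, v1).
    by law_perm.
  rewrite -(kernel_ofE _ _ hq).
  have [X0 _|X0] := eqVneq (law q rv_X1 x1) 0.
    rewrite (@law_fun_eq0 _ _ q hq.1 _ _ fst rv_X1 (fun t => t.1.1.1)) //.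
    rewrite -qp (@law_fun_eq0 _ _ q hq.1 _ _ _ rv_X1 (fun t => t.1.1)) //.
    by rewrite mul0r.
  by rewrite mulrC -mulrA => /(mulfI X0) ->; rewrite mulrC.
pose m (t : A1 * A2 * B * C1) : R := p t.1 * w1 t.1.1.1 t.2.
have m_comp (A : finType) (F : A1 * A2 * B * C1 -> A) a :
    law m F a = law q (fun w => F w.1) a.
  rewrite -[RHS](law_comp q fst F).
  by apply: law_ext => // t; rewrite m_law.
(* Y - X2 - (X1, V1, V2) yields Y - (V1, X2) - V2. *)
have x_law v1 x1 x2 y : law q [% [% rv_V1, rv_X1, rv_X2], rv_Y] (v1, x1, x2, y)
    = law q [% rv_V1, rv_X1, rv_X2] (v1, x1, x2) * W x2 y.
  have E y' : law q [% [% rv_V1, rv_X1, rv_X2], rv_Y] (v1, x1, x2, y') =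
      p12 (x1, x2) * w1 x1 v1 * W x2 y'.
    transitivity (law q fst (x1, x2, y', v1)); first by law_perm.
    by rewrite m_law source_factor /= mulrAC.
  rewrite -(law_margr _ [% rv_V1, rv_X1, rv_X2] rv_Y).
  under eq_bigr do rewrite E.
  by rewrite -mulr_sumr (kernel_ofP _ _ hp _).2 mulr1 E.
have q_law v1 x1 x2 y v2 : q (x1, x2, y, v1, v2) =
    law q [% rv_V2, [% rv_V1, rv_X1, rv_X2]] (v2, (v1, x1, x2)) * W x2 y.
  have := V2c v2 (v1, x1, x2) y; rewrite x_law.
  have -> : law q [% rv_V2, [% [% rv_V1, rv_X1, rv_X2], rv_Y]]
      (v2, (v1, x1, x2, y)) = q (x1, x2, y, v1, v2).
    by rewrite -[RHS](law_id q); law_perm.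
  have [V0 _|V0] := eqVneq (law q [% rv_V1, rv_X1, rv_X2] (v1, x1, x2)) 0.
    rewrite (@law_fun_eq0 _ _ q hq.1 _ _ _ [% rv_V1, rv_X1, rv_X2] snd) //.
    rewrite mul0r -(law_id q) (@law_fun_eq0 _ _ q hq.1 _ _ _
      [% rv_V1, rv_X1, rv_X2] (fun w => (w.1.2, w.1.1.1.1, w.1.1.1.2))) //.
  by rewrite mulrCA => E; apply: (mulIf V0); rewrite E mulrC.
have y_law v1 x2 y v2 : law q [% [% rv_Y, rv_V1, rv_X2], rv_V2] (y, v1, x2, v2)
    = law q [% rv_Y, rv_V1, rv_X2] (y, v1, x2) * w2 (v1, x2) v2.
  have E v : law q [% [% rv_Y, rv_V1, rv_X2], rv_V2] (y, v1, x2, v)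
      = law q [% rv_V1, rv_X2] (v1, x2) * w2 (v1, x2) v * W x2 y.
    rewrite kernel_ofE // -(law_margl _ rv_X1) -(law_margl _ rv_X1) mulr_suml.
    apply: eq_bigr => x1 _.
    transitivity (q (x1, x2, y, v1, v)); last first.
      by rewrite q_law; congr (_ * _); law_perm.
    by rewrite -[RHS](law_id q); law_perm.
  rewrite -(law_margr _ [% rv_Y, rv_V1, rv_X2] rv_V2).
  under eq_bigr do rewrite E.
  by rewrite -mulr_suml -mulr_sumr (hw2 _).2 mulr1 E mulrAC.
(* No information quantity involves X1 together with V2, so only laws that the replacement preserves
   get compared. *)
have mi1 : mutual_info (joint_of w1 w2) rv_X1 rv_V1 = mutual_info q rv_X1 rv_V1.
  apply: mutual_info_ext => x1 v1.
  rewrite (@joint_of_law_V1 _ _ w1 w2 hw2 _ (fun s => s.1.1) id) //.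
  by rewrite -(kernel_ofE _ _ hq); congr (_ * _); rewrite -qs.
have mi2 : cond_mutual_info (joint_of w1 w2) rv_X2 rv_V2 rv_V1
         = cond_mutual_info q rv_X2 rv_V2 rv_V1.
  apply: cond_mutual_info_ext => x2 v2 v1.
  transitivity (law (joint_of w1 w2) [% fun w => (w.1.2, w.1.1.1.2), rv_V2]
      (v1, x2, v2)); first by law_perm.
  rewrite (@joint_of_law_V2 _ _ w1 w2 _ (fun t => (t.2, t.1.1.2)) id) //.
  rewrite [law _ _ _]m_comp [LHS](kernel_ofE _ _ hq); law_perm.
have mi3 : mutual_info (joint_of w1 w2) rv_Y [% rv_V1, rv_V2]
         = mutual_info q rv_Y [% rv_V1, rv_V2].
  apply: mutual_info_ext => y -[v1 v2].
  rewrite -(law_margl _ rv_X2) -(law_margl _ rv_X2); apply: eq_bigr => x2 _.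
  transitivity (law (joint_of w1 w2)
    [% fun w => (w.1.1.2, w.1.2, w.1.1.1.2), rv_V2] (y, v1, x2, v2)).
    by law_perm.
  rewrite (@joint_of_law_V2 _ _ w1 w2 _ (fun t => (t.1.2, t.2, t.1.1.2))
    (fun t => (t.1.2, t.2))) //.
  rewrite [law _ _ _]m_comp; transitivity
    (law q [% [% rv_Y, rv_V1, rv_X2], rv_V2] (y, v1, x2, v2)); last by law_perm.
  by rewrite y_law.
by split; rewrite ?mi1 ?mi2 ?mi3.
Qed.

End KernelForm.

(** * Cardinality bounds and closedness *)

Section Caratheodory.
Context {R : realFieldType}.

(** More than [#|I|] vectors with [#|I|] coordinates are linearly dependent. The sign is chosen so
    that some coefficient is positive, which lets one move along [u] until a weight vanishes. *)
Lemma conic_dependence (C I : finType) (z : C -> I -> R) (D : {set C}) :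
  (#|I| < #|D|)%N ->
  exists u : C -> R, [/\ forall c, u c != 0 -> c \in D, exists c, 0 < u c &
    forall j, \sum_c u c * z c j = 0].
Proof.
move=> ID.
pose M := \matrix_(i < #|D|, j < #|I|) z (enum_val i) (enum_val j).
have : kermx M != 0.
  rewrite kermx_eq0 /row_free; apply: contraTneq ID => DE.
  by rewrite -leqNgt -DE rank_leq_col.
case/rowV0Pn => v /sub_kermxP vM v0.
have [i vi] : exists i, v 0 i != 0.
  apply/existsP; apply: contraNT v0; rewrite negb_exists => /forallP vz.
  by apply/eqP/rowP => i; rewrite mxE; apply/eqP; have := vz i; rewrite negbK.
wlog vi0 : v vM v0 vi / 0 < v 0 i => [wl|].
  have [|vi_lt|/eqP] := ltgtP (v 0 i) 0; last by rewrite (negbTE vi).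
    move=> vi_lt; apply: (wl (- v)); rewrite ?mulNmx ?vM ?oppr0 ?oppr_eq0 //.
      by rewrite mxE oppr_eq0.
    by rewrite mxE oppr_gt0.
  exact: (wl v).
pose u c := \sum_(k < #|D|) v 0 k * (enum_val k == c)%:R.
have uE k : u (enum_val k) = v 0 k.
  rewrite /u (bigD1 k) //= eqxx mulr1 big1 ?addr0 // => k' kk'.
  by rewrite (inj_eq enum_val_inj) (negbTE kk') mulr0.
exists u; split.
- move=> c; apply: contraNT => cD; rewrite /u big1 // => k _.
  case: eqP => [kc|_]; last by rewrite mulr0.
  by move: cD; rewrite -kc enum_valP.
- by exists (enum_val i); rewrite uE.
- move=> j; transitivity ((v *m M) 0 (enum_rank j)); last by rewrite vM mxE.
  rewrite mxE; under eq_bigr do rewrite mulr_suml.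
  rewrite exchange_big; apply: eq_bigr => k _ /=.
  rewrite mxE enum_rankK (bigD1 (enum_val k)) //= eqxx mulr1 big1 ?addr0 // => c kc.
  by rewrite eq_sym (negbTE kc) mulr0 mul0r.
Qed.

Lemma conic_support (C I : finType) (z : C -> I -> R) n (l : C -> R) :
  (forall c, 0 <= l c) -> (#|[set c | l c != 0%R]| <= n)%N ->
  exists l' : C -> R, [/\ forall c, 0 <= l' c,
    (#|[set c | l' c != 0%R]| <= #|I|)%N &
    forall j, \sum_c l' c * z c j = \sum_c l c * z c j].
Proof.
elim: n l => [|n IHn] l l0 ln.
  by exists l; split=> //; apply: leq_trans ln _.
have [lI|Il] := leqP #|[set c | l c != 0%R]| #|I|; first by exists l.
have [u [uD [c0 uc0] uz]] := conic_dependence z Il.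
case: (arg_minP (fun c => l c / u c) (P := fun c => 0 < u c) uc0) => c1 uc1 c1min.
(* The largest step along - u that keeps all weights nonnegative; the weight of [c1] then becomes
   0. *)
pose t := l c1 / u c1.
have t0 : 0 <= t by rewrite divr_ge0 // ltW.
pose l' c := l c - t * u c.
have l'0 c : 0 <= l' c.
  rewrite subr_ge0; have [uc|uc] := ltP 0 (u c).
    by rewrite -ler_pdivlMr //; apply: c1min.
  by apply: le_trans (l0 c); rewrite mulr_ge0_le0.
have l'n : (#|[set c | l' c != 0%R]| <= n)%N.
  rewrite -ltnS; apply: leq_trans ln; apply: proper_card.
  apply/properP; split.
    apply/fintype.subsetP => c; rewrite !inE; apply: contraNneq => lc.
    rewrite /l' lc sub0r oppr_eq0 mulf_eq0; apply/orP; right.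
    by apply/negPn/negP => /uD; rewrite inE lc eqxx.
  have uc1' : u c1 != 0 by rewrite gt_eqF.
  exists c1; first exact: uD.
  by rewrite inE /l' /t divfK // subrr eqxx.
have [l2 [l20 l2I l2z]] := IHn l' l'0 l'n.
exists l2; split=> // j; rewrite l2z /l'.
under eq_bigr do rewrite mulrBl -mulrA.
by rewrite sumrB -mulr_sumr uz mulr0 subr0.
Qed.

(** The surviving letters are relabelled by [I] itself, with weight 0 on the spare labels, so the
    new alphabet depends only on the set of constraints. *)
Lemma conic_caratheodory (C I : finType) (c0 : C) (z : C -> I -> R) :
  exists (sigma : I -> C) (l : I -> R), (forall i, 0 <= l i) /\
    forall j, \sum_i l i * z (sigma i) j = \sum_c z c j.
Proof.
have [l [l0 lI lz]] := @conic_support C I z _ (fun=> 1) (fun=> ler01) (leqnn _).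
pose D := [set c | l c != 0].
pose sigma (i : I) := nth c0 (enum D) (enum_rank i).
exists sigma, (fun i => if (enum_rank i < #|D|)%N then l (sigma i) else 0); split.
  by move=> i; case: ifP.
move=> j; transitivity (\sum_c l c * z c j); last first.
  by rewrite lz; apply: eq_bigr => c _; rewrite mul1r.
transitivity (\sum_(c in D) l c * z c j); last first.
  rewrite big_mkcond; apply: eq_bigr => c _; rewrite inE.
  by case: eqVneq => //= ->; rewrite mul0r.
rewrite (reindex_onto enum_val enum_rank) /=; last by move=> *; rewrite enum_rankK.
have DI : (size (enum D) <= #|I|)%N by rewrite -cardE.
rewrite -[RHS]big_enum /= (big_nth c0) big_mkord.
rewrite (big_ord_widen _ (fun k => l (nth c0 (enum D) k) * z (nth c0 (enum D) k) j) DI).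
rewrite [RHS]big_mkcond; apply: eq_big => k; first by rewrite enum_valK eqxx.
by move=> _; rewrite /sigma enum_valK [#|D|]cardE; case: ifP => // _; rewrite mul0r.
Qed.

End Caratheodory.

(** * Joint laws cut along the letters of the auxiliary variables *)

Section Slices.
Context {R : realType} {S C1 C2 : finType}.
Variable q : S * C1 * C2 -> R.

(** Law of (F(S), V1, V2), written so as to be visibly linear in the column of [q] at (v1, v2):
    reweighting or relabelling letters acts on it termwise. *)
Definition slice12 (A : finType) (F : S -> A) a v1 v2 : R :=
  \sum_s q (s, v1, v2) * (F s == a)%:R.
Definition slice1 (A : finType) (F : S -> A) a v1 : R :=
  \sum_v2 slice12 F a v1 v2.
Definition slice0 (A : finType) (F : S -> A) a : R := \sum_v1 slice1 F a v1.

Lemma law_slice12 (A : finType) (F : S -> A) a v1 v2 :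
  law q (fun w => (F w.1.1, w.1.2, w.2)) (a, v1, v2) = slice12 F a v1 v2.
Proof.
rewrite lawE sum_prod sum_prod /slice12; apply: eq_bigr => s _.
rewrite (bigD1 v1) //= (bigD1 v2) //= big1 ?addr0 => [|v2' /negbTE v2v]; last first.
  by rewrite xpair_eqE v2v andbF mulr0.
rewrite big1 ?addr0 => [|v1' /negbTE v1v]; last first.
  by apply: big1 => v2' _; rewrite !xpair_eqE v1v andbF mulr0.
by rewrite !xpair_eqE !eqxx !andbT.
Qed.

Lemma law_slice1 (A : finType) (F : S -> A) a v1 :
  law q (fun w => (F w.1.1, w.1.2)) (a, v1) = slice1 F a v1.
Proof.
rewrite -(law_margr _ (fun w => (F w.1.1, w.1.2)) snd).
by apply: eq_bigr => v2 _; rewrite -law_slice12.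
Qed.

Lemma law_slice0 (A : finType) (F : S -> A) a :
  law q (fun w => F w.1.1) a = slice0 F a.
Proof.
rewrite -(law_margr _ (fun w => F w.1.1) (fun w => w.1.2)).
by apply: eq_bigr => v1 _; rewrite -law_slice1.
Qed.

End Slices.

Section SliceForm.
Context {R : realType} {A1 A2 B : finType}.
Local Notation S := (A1 * A2 * B)%type.
Variable p : S -> R.
Hypothesis hp : is_pmf p.

Definition info_term (a b c : R) := a * log2 (a / (b * c)).
Definition cond_info_term (a b c d : R) := a * log2 (a / d / (b / d * (c / d))).

Lemma info_term_scale l a b c : info_term (l * a) b (l * c) = l * info_term a b c.
Proof.
rewrite /info_term; have [->|l0] := eqVneq l 0; first by rewrite !mul0r.
by rewrite [b * _]mulrCA -mulf_div divff // mul1r mulrA.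
Qed.

(** Reweighting a letter of V2 leaves the laws that involve only V1 alone, so [b] and [d] stay
    fixed. *)
Lemma cond_info_term_scale l a b c d :
  cond_info_term (l * a) b (l * c) d = l * cond_info_term a b c d.
Proof.
rewrite /cond_info_term; have [->|l0] := eqVneq l 0; first by rewrite !mul0r.
rewrite -[l * a / d]mulrA -[l * c / d]mulrA [b / d * (l * _)]mulrCA.
by rewrite -mulf_div divff // mul1r mulrA.
Qed.

(** Reweighting a letter of V1 scales all four masses. *)
Lemma cond_info_term_scale4 l a b c d :
  cond_info_term (l * a) (l * b) (l * c) (l * d) = l * cond_info_term a b c d.
Proof.
rewrite /cond_info_term; have [->|l0] := eqVneq l 0; first by rewrite !mul0r.
have E x : l * x / (l * d) = x / d by rewrite -mulf_div divff // mul1r.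
by rewrite !E [RHS]mulrA.
Qed.

Section OneJoint.
Context {C1 C2 : finType}.
Variable q : S * C1 * C2 -> R.

Lemma mutual_info1_slice : mutual_info q rv_X1 rv_V1 =
  \sum_v1 \sum_x1 info_term (slice1 q (fun s => s.1.1) x1 v1)
    (slice0 q (fun s => s.1.1) x1) (slice1 q (fun=> tt) tt v1).
Proof.
rewrite /mutual_info exchange_big; apply: eq_bigr => v1 _; apply: eq_bigr => x1 _.
rewrite -!law_slice1 -law_slice0 /info_term.
by congr (_ * log2 (_ / (_ * _))); law_perm.
Qed.

Lemma cond_mutual_info_slice : cond_mutual_info q rv_X2 rv_V2 rv_V1 =
  \sum_v1 \sum_v2 \sum_x2 cond_info_term (slice12 q (fun s => s.1.2) x2 v1 v2)
    (slice1 q (fun s => s.1.2) x2 v1) (slice12 q (fun=> tt) tt v1 v2)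
    (slice1 q (fun=> tt) tt v1).
Proof.
rewrite /cond_mutual_info exchange_big /=.
under eq_bigr do rewrite exchange_big /=.
rewrite exchange_big; apply: eq_bigr => v1 _; apply: eq_bigr => v2 _.
apply: eq_bigr => x2 _; rewrite -!law_slice1 -!law_slice12 /cond_law /cond_info_term.
by congr (_ * log2 (_ / _ / (_ / _ * (_ / _)))); law_perm.
Qed.

Lemma mutual_info2_slice : mutual_info q rv_Y [% rv_V1, rv_V2] =
  \sum_v1 \sum_v2 \sum_y info_term (slice12 q snd y v1 v2)
    (slice0 q snd y) (slice12 q (fun=> tt) tt v1 v2).
Proof.
rewrite /mutual_info exchange_big sum_prod.
apply: eq_bigr => v1 _; apply: eq_bigr => v2 _; apply: eq_bigr => y _.
rewrite -!law_slice12 -law_slice0 /info_term.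
by congr (_ * log2 (_ / (_ * _))); law_perm.
Qed.

(** The chains are cross-multiplied, hence homogeneous in the slice of a letter; total mass 1
    follows from the source marginal. *)
Definition hat_slices (r : R * R * R) : Prop :=
  [/\ forall w, 0 <= q w, forall s, slice0 q id s = p s,
      rate_constraints q r.1.1 r.1.2 r.2,
      forall s v1, slice1 q id s v1 * slice0 q (fun s => s.1.1) s.1.1 =
                   slice1 q (fun s => s.1.1) s.1.1 v1 * slice0 q id s &
      forall s v1 v2, slice12 q id s v1 v2 * slice1 q fst s.1 v1 =
                   slice12 q fst s.1 v1 v2 * slice1 q id s v1].

Lemma hat_slicesP r : hat_slices r <->
  [/\ extends_source p q, rate_constraints q r.1.1 r.1.2 r.2,
      markov_chain q rv_V1 rv_X1 [% rv_X2, rv_Y] &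
      markov_chain q rv_V2 [% rv_V1, rv_X1, rv_X2] rv_Y].
Proof.
have e0 s : slice0 q id s = law q [% rv_X1, rv_X2, rv_Y] s.
  by rewrite -law_slice0; case: s => [[? ?] ?]; law_perm.
have e01 x1 : slice0 q (fun s => s.1.1) x1 = law q rv_X1 x1.
  by rewrite -law_slice0; law_perm.
have e03 x1 x2 y : slice0 q id (x1, x2, y) =
    law q [% rv_X1, [% rv_X2, rv_Y]] (x1, (x2, y)).
  by rewrite -law_slice0; law_perm.
have e1 x1 x2 y v1 : slice1 q id (x1, x2, y) v1 =
    law q [% rv_V1, [% rv_X1, [% rv_X2, rv_Y]]] (v1, (x1, (x2, y))).
  by rewrite -law_slice1; law_perm.
have e1' x1 x2 y v1 : slice1 q id (x1, x2, y) v1 =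
    law q [% [% rv_V1, rv_X1, rv_X2], rv_Y] (v1, x1, x2, y).
  by rewrite -law_slice1; law_perm.
have e11 x1 v1 : slice1 q (fun s => s.1.1) x1 v1 = law q [% rv_V1, rv_X1] (v1, x1).
  by rewrite -law_slice1; law_perm.
have e112 x1 x2 v1 : slice1 q fst (x1, x2) v1 =
    law q [% rv_V1, rv_X1, rv_X2] (v1, x1, x2).
  by rewrite -law_slice1; law_perm.
have e2 x1 x2 y v1 v2 : slice12 q id (x1, x2, y) v1 v2 =
    law q [% rv_V2, [% [% rv_V1, rv_X1, rv_X2], rv_Y]] (v2, (v1, x1, x2, y)).
  by rewrite -law_slice12; law_perm.
have e212 x1 x2 v1 v2 : slice12 q fst (x1, x2) v1 v2 =
    law q [% rv_V2, [% rv_V1, rv_X1, rv_X2]] (v2, (v1, x1, x2)).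
  by rewrite -law_slice12; law_perm.
split.
- case=> q0 qs rates c1 c2; split=> //.
  + split; last by move=> s; rewrite -e0.
    split=> //; rewrite -(sum_law _ [% rv_X1, rv_X2, rv_Y]) -hp.2.
    by apply: eq_bigr => s _; rewrite -e0.
  + apply/(markov_chainE _ _ _ q0) => v1 x1 -[x2 y].
    by rewrite -e1 -e01 -e11 -e03 c1.
  + apply/(markov_chainE _ _ _ q0) => v2 -[[v1 x1] x2] y.
    by rewrite -e2 -e112 -e212 -e1' c2.
- case=> -[hq qs] rates c1 c2; split=> //.
  + exact: hq.1.
  + by move=> s; rewrite e0.
  + move=> [[x1 x2] y] v1; move/(markov_chainE _ _ _ hq.1): c1 => c1.
    by rewrite e1 e01 e11 e03 c1.
  + move=> [[x1 x2] y] v1 v2; move/(markov_chainE _ _ _ hq.1): c2 => c2.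
    by rewrite e2 e112 e212 e1' c2.
Qed.

End OneJoint.

(* The constraints and the information quantities are sums over the letters of
   the auxiliary alphabet of terms that are homogeneous of degree 1 in the slice
   of that letter, so conic Caratheodory applies. The reduction is made for each
   [v1] separately; labels that get repeated are harmless. *)
Lemma reduce_V2 (C1 C2 : finType) (q : S * C1 * C2 -> R) r :
  hat_slices q r -> exists q' : S * C1 * (S + 'I_2) -> R, hat_slices q' r.
Proof.
case=> q0 qs [r1 r2 r3] c1 c2.
(* The coordinates [inl s] preserve the joint law of the source and v1, hence all that does not
   involve V2; the two others preserve the parts of the two information sums that belong to this
   v1. *)
pose z v1 v2 (i : S + 'I_2) := match i with
  | inl s => q (s, v1, v2)
  | inr i => if i == ord0 then
      \sum_x2 cond_info_term (slice12 q (fun s => s.1.2) x2 v1 v2)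
        (slice1 q (fun s => s.1.2) x2 v1) (slice12 q (fun=> tt) tt v1 v2)
        (slice1 q (fun=> tt) tt v1)
    else \sum_y info_term (slice12 q snd y v1 v2)
        (slice0 q snd y) (slice12 q (fun=> tt) tt v1 v2)
  end.
have [v2_ _|C20] := pickP (@predT C2); last first.
  have := hp.2; rewrite big1 => [/eqP|s _]; first by rewrite eq_sym oner_eq0.
  by rewrite -qs /slice0 big1 // => v1 _; rewrite /slice1 big_pred0.
have [sigma /choice [l]] := choice (fun v1 => conic_caratheodory v2_ (z v1)).
move=> /all_and2 [l0 lz].
pose q' (w : S * C1 * (S + 'I_2)) :=
  l w.1.2 w.2 * q (w.1, sigma w.1.2 w.2).
have q'12 (A : finType) (F : S -> A) a v1 i :
    slice12 q' F a v1 i = l v1 i * slice12 q F a v1 (sigma v1 i).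
  by rewrite /slice12 mulr_sumr; apply: eq_bigr => s _; rewrite /q' mulrA.
have q'1 (A : finType) (F : S -> A) a v1 : slice1 q' F a v1 = slice1 q F a v1.
  rewrite /slice1 /slice12 exchange_big [RHS]exchange_big; apply: eq_bigr => s _ /=.
  by rewrite -!mulr_suml (lz v1 (inl s)).
have q'0 (A : finType) (F : S -> A) a : slice0 q' F a = slice0 q F a.
  by apply: eq_bigr => v1 _; rewrite q'1.
exists q'; split.
- by move=> w; rewrite mulr_ge0.
- by move=> s; rewrite q'0.
- split.
  + suff -> : mutual_info q' rv_X1 rv_V1 = mutual_info q rv_X1 rv_V1 by [].
    rewrite !mutual_info1_slice; apply: eq_bigr => v1 _; apply: eq_bigr => x1 _.
    by rewrite !q'1 q'0.
  + suff -> : cond_mutual_info q' rv_X2 rv_V2 rv_V1 =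
      cond_mutual_info q rv_X2 rv_V2 rv_V1 by [].
    rewrite !cond_mutual_info_slice; apply: eq_bigr => v1 _.
    rewrite -[RHS](lz v1 (inr ord0)) /=; apply: eq_bigr => i _.
    rewrite mulr_sumr; apply: eq_bigr => x2 _.
    by rewrite !q'1 !q'12 cond_info_term_scale.
  + suff -> : mutual_info q' rv_Y [% rv_V1, rv_V2] =
      mutual_info q rv_Y [% rv_V1, rv_V2] by [].
    rewrite !mutual_info2_slice; apply: eq_bigr => v1 _.
    rewrite -[RHS](lz v1 (inr ord_max)) /=; apply: eq_bigr => i _.
    rewrite mulr_sumr; apply: eq_bigr => y _.
    by rewrite !q'0 !q'12 info_term_scale.
- by move=> s v1; rewrite !q'1 !q'0.
- by move=> s v1 i; rewrite !q'1 !q'12 -!mulrA c2.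
Qed.

Lemma reduce_V1 (C1 C2 : finType) (q : S * C1 * C2 -> R) r :
  hat_slices q r -> exists q' : S * (S + 'I_3) * C2 -> R, hat_slices q' r.
Proof.
case=> q0 qs [r1 r2 r3] c1 c2.
(* The coordinates [inl s] preserve the source law, the other three the information quantities. The
   sums over V2 stay inside a coordinate, since V2 is carried along with its letter v1. *)
pose z v1 (i : S + 'I_3) := match i with
  | inl s => slice1 q id s v1
  | inr i => if i == ord0 then
      \sum_x1 info_term (slice1 q (fun s => s.1.1) x1 v1)
        (slice0 q (fun s => s.1.1) x1) (slice1 q (fun=> tt) tt v1)
    else if i == ord_max then
      \sum_v2 \sum_x2 cond_info_term (slice12 q (fun s => s.1.2) x2 v1 v2)
        (slice1 q (fun s => s.1.2) x2 v1) (slice12 q (fun=> tt) tt v1 v2)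
        (slice1 q (fun=> tt) tt v1)
    else \sum_v2 \sum_y info_term (slice12 q snd y v1 v2)
        (slice0 q snd y) (slice12 q (fun=> tt) tt v1 v2)
  end.
have [v1_ _|C10] := pickP (@predT C1); last first.
  have := hp.2; rewrite big1 => [/eqP|s _]; first by rewrite eq_sym oner_eq0.
  by rewrite -qs /slice0 big_pred0.
have [sigma [l [l0 lz]]] := conic_caratheodory v1_ z.
pose q' (w : S * (S + 'I_3) * C2) := l w.1.2 * q (w.1.1, sigma w.1.2, w.2).
have q'12 (A : finType) (F : S -> A) a i v2 :
    slice12 q' F a i v2 = l i * slice12 q F a (sigma i) v2.
  by rewrite /slice12 mulr_sumr; apply: eq_bigr => s _; rewrite /q' mulrA.
have q'1 (A : finType) (F : S -> A) a i :
    slice1 q' F a i = l i * slice1 q F a (sigma i).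
  by rewrite /slice1 mulr_sumr; apply: eq_bigr => v2 _.
have slice1_id (A : finType) (F : S -> A) a v1 :
    slice1 q F a v1 = \sum_s slice1 q id s v1 * (F s == a)%:R.
  rewrite /slice1 /slice12 exchange_big; apply: eq_bigr => s _ /=.
  rewrite -mulr_suml; congr (_ * _); apply: eq_bigr => v2 _.
  rewrite (bigD1 s) //= eqxx mulr1 big1 ?addr0 // => s' /negbTE ->.
  by rewrite mulr0.
have q'0 (A : finType) (F : S -> A) a : slice0 q' F a = slice0 q F a.
  rewrite /slice0; under eq_bigr do rewrite q'1 slice1_id mulr_sumr.
  under [RHS]eq_bigr do rewrite slice1_id.
  rewrite exchange_big [RHS]exchange_big; apply: eq_bigr => s _ /=.
  rewrite -mulr_suml -(lz (inl s)) mulr_suml; apply: eq_bigr => i _.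
  by rewrite mulrA.
exists q'; split.
- by move=> w; rewrite mulr_ge0.
- by move=> s; rewrite q'0.
- split.
  + suff -> : mutual_info q' rv_X1 rv_V1 = mutual_info q rv_X1 rv_V1 by [].
    rewrite !mutual_info1_slice -[RHS](lz (inr ord0)) /=; apply: eq_bigr => i _.
    rewrite mulr_sumr; apply: eq_bigr => x1 _.
    by rewrite !q'1 q'0 info_term_scale.
  + suff -> : cond_mutual_info q' rv_X2 rv_V2 rv_V1 =
      cond_mutual_info q rv_X2 rv_V2 rv_V1 by [].
    rewrite !cond_mutual_info_slice -[RHS](lz (inr ord_max)) /=.
    apply: eq_bigr => i _; rewrite mulr_sumr; apply: eq_bigr => v2 _.
    rewrite mulr_sumr; apply: eq_bigr => x2 _.
    by rewrite !q'1 !q'12 cond_info_term_scale4.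
  + suff -> : mutual_info q' rv_Y [% rv_V1, rv_V2] =
      mutual_info q rv_Y [% rv_V1, rv_V2] by [].
    rewrite !mutual_info2_slice -[RHS](lz (inr (lift ord0 ord0))) /=.
    apply: eq_bigr => i _; rewrite mulr_sumr; apply: eq_bigr => v2 _.
    rewrite mulr_sumr; apply: eq_bigr => y _.
    by rewrite !q'0 !q'12 info_term_scale.
- by move=> s i; rewrite !q'1 !q'0 -!mulrA c1.
- by move=> s i v2; rewrite !q'1 !q'12 mulrACA c2 mulrACA.
Qed.

Lemma hat_bounded_alphabets r : single_letter_hat p r ->
  exists q : S * (S + 'I_3) * (S + 'I_2) -> R, hat_slices q r.
Proof.
case: r => [[R1 R2] mu] [C1 [C2 [q /(hat_slicesP q (R1, R2, mu)) hq]]].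
by have [q2 /reduce_V1] := reduce_V2 hq.
Qed.

End SliceForm.
Local Open Scope classical_set_scope.

(** * Continuity of x log x and limits of information quantities *)

Section XLog.
Context {R : realType}.

(** Above, ln x <= x. Below, with s the square root of x, - ln x = 2 ln (1 / s) <= 2 / s. For x <= 0
    the logarithm is 0. *)
Lemma normr_xln (x : R) : `|x * ln x| <= 2 * Num.sqrt `|x| + x ^+ 2.
Proof.
have [x0|x0] := leP x 0.
  by rewrite ln0 // mulr0 normr0 addr_ge0 ?sqr_ge0 // mulr_ge0 // sqrtr_ge0.
rewrite (gtr0_norm x0) ler_norml; apply/andP; split; last first.
  apply: (@le_trans _ _ (x ^+ 2)); last by rewrite lerDr mulr_ge0 // sqrtr_ge0.
  by rewrite expr2 ler_pM2l // ltW // ln_sublinear.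
set s := Num.sqrt x; have s0 : 0 < s by rewrite sqrtr_gt0.
have -> : x = s ^+ 2 by rewrite sqr_sqrtr // ltW.
rewrite lnXn // lerNl -mulrN -mulNrn -lnV ?posrE //.
apply: (@le_trans _ _ (2 * s)); last by rewrite lerDl sqr_ge0.
have := @ln_sublinear _ s^-1; rewrite invr_gt0 => /(_ s0) /ltW h.
have -> : 2 * s = s ^+ 2 * (s^-1 *+ 2).
  by rewrite mulr2n; field; rewrite gt_eqF.
by rewrite ler_pM2l ?exprn_gt0 // lerMn2r.
Qed.

Lemma continuous_xlog2 : continuous (fun x : R => x * log2 x).
Proof.
move=> x; rewrite /log2.
have [x0|x0|->] := ltgtP x 0; last 1 first.
- have xln0 : (fun y : R => y * ln y) @ (0 : R) --> (0 : R).
    apply/norm_cvg0P.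
    apply: (@squeeze_cvgr _ _ _ _ (cst 0) (fun y => 2 * Num.sqrt `|y| + y ^+ 2)).
    + by apply: nearW => y; rewrite normr_ge0 normr_xln.
    + exact: cvg_cst.
    + rewrite [X in _ --> X](_ : 0 = 2 * Num.sqrt `|0 : R| + 0 ^+ 2 :> R); last first.
        by rewrite normr0 sqrtr0 mulr0 expr2 mulr0 addr0.
      apply: cvgD; last exact: (@exprn_continuous R 2 0).
      apply: cvgM; first exact: cvg_cst.
      apply: (@continuous_comp _ _ _ (fun y : R => `|y|) (@Num.sqrt R) 0).
        exact: norm_continuous.
      exact: sqrt_continuous.
  have := cvgM xln0 (cvg_cst (ln 2)^-1); rewrite mul0r => lim0.
  rewrite /continuous_at mul0r.
  rewrite (_ : (fun x => _) = (fun x : R => x * ln x / ln 2)); last first.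
    by apply/funext => y; rewrite mulrA.
  exact: lim0.
- apply: (near_cst_continuous 0); near=> y.
  rewrite ln0 ?mul0r ?mulr0 //; apply: ltW; near: y; exact: lt_nbhsl.
- apply: cvgM; first exact: cvg_id.
  by apply: cvgM (cvg_cst _); apply: continuous_ln.
Unshelve. all: by end_near. Qed.

End XLog.

Lemma ultra_fmap (T U : Type) (f : T -> U) (F : set_system T) :
  UltraFilter F -> UltraFilter (f @ F).
Proof.
move=> FU; split; first exact: fmap_proper_filter.
move=> G GP FG; apply/seteqP; split=> // A GA.
have [//|FA] := in_ultra_setVsetC (f @^-1` A) FU.
have GnA : G (~` A) by apply: FG.
by have /filter_ex[x []] : G (A `&` ~` A) by apply: filterI.
Qed.

Section LimitLaws.
Context {R : realType} {W : finType} {F : set_system nat} {FF : ProperFilter F}.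
Variables (q_ : nat -> W -> R) (q : W -> R).
Hypothesis q_cvg : forall w, q_ n w @[n --> F] --> q w.

Lemma cvg_law (A : finType) (X : W -> A) a :
  law (q_ n) X a @[n --> F] --> law q X a.
Proof. by apply: cvg_big => //; exact: add_continuous. Qed.

Lemma cvg_entropy (A : finType) (X : W -> A) :
  entropy (q_ n) X @[n --> F] --> entropy q X.
Proof.
apply: cvgN; apply: cvg_big => [|a _]; first exact: add_continuous.
apply: (cvg_comp (fun n => law (q_ n) X a) (fun x : R => x * log2 x)).
  exact: cvg_law.
exact: continuous_xlog2.
Qed.

Hypothesis q_ge0 : forall n w, 0 <= q_ n w.

Lemma limit_ge0 w : 0 <= q w.
Proof. by apply: (cvgr_to_ge (@q_cvg w)); apply: nearW => n. Qed.

(** Entropies are continuous even where a marginal vanishes, which is not apparent on the quotient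
    form. *)
Lemma cvg_mutual_info (A C : finType) (X : W -> A) (Y : W -> C) :
  mutual_info (q_ n) X Y @[n --> F] --> mutual_info q X Y.
Proof.
rewrite (mutual_info_entropy limit_ge0).
under eq_fun do rewrite mutual_info_entropy //.
by apply: cvgB; [apply: cvgD|]; exact: cvg_entropy.
Qed.

Lemma cvg_cond_mutual_info (A C D : finType) (X : W -> A) (Y : W -> C)
    (Z : W -> D) :
  cond_mutual_info (q_ n) X Y Z @[n --> F] --> cond_mutual_info q X Y Z.
Proof.
rewrite (cond_mutual_info_entropy limit_ge0).
under eq_fun do rewrite cond_mutual_info_entropy //.
by apply: cvgB; [apply: cvgB; [apply: cvgD|]|]; exact: cvg_entropy.
Qed.

End LimitLaws.

Lemma eq_cvg_lim (R : realType) {F : set_system nat} {FF : ProperFilter F}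
    (f g : nat -> R) (a b : R) :
  f @ F --> a -> g @ F --> b -> f =1 g -> a = b.
Proof. by move=> fa gb /funext fg; apply: (cvg_unique (@Rhausdorff R) fa); rewrite fg. Qed.

Section HatClosed.
Context {R : realType} {A1 A2 B : finType}.
Variable p : A1 * A2 * B -> R.
Hypothesis hp : is_pmf p.

(* An ultrafilter on [nat] provides pointwise limits of the joint laws without a
   compactness argument in the space of laws. *)
Lemma hat_closed R1 R2 mu :
    (forall eps, 0 < eps -> single_letter_hat p (R1 + eps, R2 + eps, mu - eps)) ->
  single_letter_hat p (R1, R2, mu).
Proof.
move=> hat_eps.
pose e n : R := n.+1%:R^-1.
have e0 n : 0 < e n by rewrite invr_gt0 ltr0n.
(* Bounded alphabets put all the [q_ n] on one finite type, so that a pointwise limit makes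
   sense. *)
have /choice [q_ hq_] n := hat_bounded_alphabets hp (hat_eps _ (e0 n)).
have q_ge0 n w : 0 <= q_ n w by case: (hq_ n).
have q_le1 n w : q_ n w <= 1.
  have /hat_slicesP [] := hq_ n => // -[[_ <-] _] _ _ _.
  by rewrite (bigD1 w) //= lerDl sumr_ge0.
have [U [UU Uoo]] := ultraFilterLemma (eventually_filter : ProperFilter \oo).
have /choice [q q_cvg] w : exists x : R, q_ n w @[n --> U] --> x.
  have := @segment_compact R 0 1; rewrite compact_ultra => /(_ _
    (ultra_fmap (fun n => q_ n w) UU)) [|x [_ qx]]; last by exists x.
  by apply: nearW => n /=; rewrite in_itv /= q_ge0 q_le1.
have q0 w : 0 <= q w by exact: (limit_ge0 q_cvg q_ge0).
have e_cvg : e n @[n --> U] --> (0 : R).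
  by apply: cvg_trans (cvg_harmonic (R := R)); apply: cvg_app.
have law_eq (A A' C C' : finType) (X : _ -> A) (X' : _ -> A') (Y : _ -> C)
    (Y' : _ -> C') a a' c c' :
    (forall n, law (q_ n) X a * law (q_ n) X' a' =
               law (q_ n) Y c * law (q_ n) Y' c') ->
  law q X a * law q X' a' = law q Y c * law q Y' c'.
  move=> E; have lim_mul (D D' : finType) (Z : _ -> D) (Z' : _ -> D') d d' :
      law (q_ n) Z d * law (q_ n) Z' d' @[n --> U] --> law q Z d * law q Z' d'.
    by apply: cvgM; apply: cvg_law.
  exact: (eq_cvg_lim (lim_mul _ _ X X' a a') (lim_mul _ _ Y Y' c c') E).
exists _, _, q; split.
- split; last first.
    move=> s; apply: (@eq_cvg_lim R U _
        (fun n => law (q_ n) [% rv_X1, rv_X2, rv_Y] s) (fun=> p s)).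
    + exact: cvg_law.
    + exact: cvg_cst.
    + by move=> n; have /hat_slicesP [] := hq_ n => // -[_ ->].
  split; first exact: q0.
  apply: (@eq_cvg_lim R U _ (fun n => \sum_w q_ n w) (fun=> 1)
    (\sum_w q w) 1).
  + by apply: cvg_big => //; exact: add_continuous.
  + exact: cvg_cst.
  + by move=> n; have /hat_slicesP [] := hq_ n => // -[[]].
- have rates n : rate_constraints (q_ n) (R1 + e n) (R2 + e n) (mu - e n).
    by have /hat_slicesP [] := hq_ n.
  split.
  + apply: (@ler_cvg_to nat U _ R (fun n => mutual_info (q_ n) rv_X1 rv_V1)
      (fun n => R1 + e n)).
    * exact: cvg_mutual_info.
    * by rewrite -[X in _ --> X]addr0; apply: cvgD => //; exact: cvg_cst.
    * by apply: nearW => n; case: (rates n).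
  + apply: (@ler_cvg_to nat U _ R
      (fun n => cond_mutual_info (q_ n) rv_X2 rv_V2 rv_V1) (fun n => R2 + e n)).
    * exact: cvg_cond_mutual_info.
    * by rewrite -[X in _ --> X]addr0; apply: cvgD => //; exact: cvg_cst.
    * by apply: nearW => n; case: (rates n).
  + apply: (@ler_cvg_to nat U _ R (fun n => mu - e n)
      (fun n => mutual_info (q_ n) rv_Y [% rv_V1, rv_V2])).
    * by rewrite -[X in _ --> X]subr0; apply: cvgB => //; exact: cvg_cst.
    * exact: cvg_mutual_info.
    * by apply: nearW => n; case: (rates n).
- apply/(markov_chainE _ _ _ q0) => a b c; apply: law_eq => n.
  have /hat_slicesP [] := hq_ n => // -[[q_0 _] _] _ h _.
  exact: (proj1 (markov_chainE _ _ _ q_0) h).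
- apply/(markov_chainE _ _ _ q0) => a b c; apply: law_eq => n.
  have /hat_slicesP [] := hq_ n => // -[[q_0 _] _] _ _ h.
  exact: (proj1 (markov_chainE _ _ _ q_0) h).
Qed.

End HatClosed.

(** * Achievability *)

Section Covering.
Context {R : realType}.

Lemma pmf_average (W : finType) (p F : W -> R) :
  is_pmf p -> exists w, F w <= \sum_w p w * F w.
Proof.
move=> [p0 p1]; set E := \sum_w _; apply: contrapT => /forallNP FE.
have {}FE w : E < F w by rewrite ltNge; apply/negP/FE.
have : \sum_w p w * (F w - E) <= 0.
  under eq_bigr do rewrite mulrBr.
  by rewrite sumrB -mulr_suml p1 mul1r subrr.
rewrite leNgt => /negP; apply.
have pFE w : 0 <= p w * (F w - E) by rewrite mulr_ge0 // subr_ge0 ltW.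
have [w pw] : exists w, p w != 0.
  apply/existsP; apply: contra_eqT p1; rewrite negb_exists => /forallP pz.
  rewrite big1 => [|w _]; first by rewrite eq_sym oner_eq0.
  by have /negPn/eqP := pz w.
rewrite (bigD1 w) //= ltr_pwDl ?sumr_ge0 // mulr_gt0 ?subr_gt0 //.
by rewrite lt_def pw p0.
Qed.

(** The chain is (1 - s)^M <= exp (- s M) <= exp (- K a) <= 1 / (1 + K a) <= 1 - a + 1 / K; the
    rational bound reduces the last step to algebra. *)
Lemma expr1B_le (a s K : R) M :
  0 <= a <= 1 -> s <= 1 -> 0 < K -> K * a <= s * M%:R ->
  (1 - s) ^+ M <= 1 - a + K^-1.
Proof.
move=> /andP[a0 a1] s1 K0 KaM.
have Ka0 : 0 < 1 + K * a by rewrite ltr_wpDr // mulr_ge0 // ltW.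
apply: (@le_trans _ _ (1 + K * a)^-1).
  apply: (@le_trans _ _ (expR (- s) ^+ M)).
    by apply: lerXn2r; rewrite ?nnegrE ?subr_ge0 ?expR_ge0 ?expR_ge1Dx.
  rewrite -expRM_natr mulNr expRN lef_pV2 ?posrE ?expR_gt0 //.
  by apply: le_trans (expR_ge1Dx _); rewrite lerD2l.
rewrite -[_^-1]mul1r ler_pdivrMr // -subr_ge0.
have -> : (1 - a + K^-1) * (1 + K * a) - 1 = K * a * (1 - a) + K^-1.
  by field; rewrite gt_eqF.
by rewrite addr_ge0 ?invr_ge0 ?(ltW K0) // !mulr_ge0 ?subr_ge0 // ltW.
Qed.

(* A random codebook drawn from [r] misses the set [T x] with probability
   [(1 - r (T x)) ^ M]; the density bound compares [r (T x)] with [w x (T x)]. *)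
Lemma covering (X V : finType) (a : X -> R) (r : V -> R) (w : X -> V -> R)
    (T : X -> V -> bool) (L : R) (M : nat) :
  (forall x, 0 <= a x) -> is_pmf r -> is_kernel w -> 0 < L ->
  (forall x v, T x v -> w x v <= L * r v) ->
  exists (c : 'I_M.+1 -> V) (f : X -> 'I_M.+1),
    \sum_x a x * (~~ T x (c (f x)))%:R <=
    \sum_x a x * (\sum_v w x v * (~~ T x v)%:R + L / M.+1%:R).
Proof.
move=> a0 [r0 r1] hw L0 wT.
pose miss (c : {ffun 'I_M.+1 -> V}) := \sum_x a x * \prod_i (~~ T x (c i))%:R.
pose pc (c : {ffun 'I_M.+1 -> V}) := \prod_i r (c i).
have hpc : is_pmf pc.
  split=> [c|]; first by apply: prodr_ge0.
  by rewrite -(bigA_distr_bigA (fun=> r)) /= big1.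
have [c missc] := pmf_average miss hpc.
(* When no codeword fits, the index is arbitrary and counts as a miss. *)
pose f x := odflt ord0 [pick i | T x (c i)].
exists c, f.
have miss_le x : (~~ T x (c (f x)))%:R <= \prod_i (~~ T x (c i))%:R :> R.
  rewrite /f; case: pickP => [i ->|none /=]; first by apply: prodr_ge0.
  by rewrite none big1 // => i _; rewrite none.
apply: (@le_trans _ _ (miss c)).
  by apply: ler_sum => x _; apply: ler_wpM2l.
apply: le_trans missc _.
rewrite /miss; under eq_bigr do rewrite mulr_sumr.
rewrite exchange_big; apply: ler_sum => x _ /=.
under eq_bigr => c' _ do rewrite mulrCA /pc -big_split /=.
rewrite -mulr_sumr; apply: ler_wpM2l => //.
rewrite -(bigA_distr_bigA (fun _ v => r v * (~~ T x v)%:R)) /=.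
rewrite prodr_const card_ord.
pose s := \sum_v r v * (T x v)%:R; pose al := \sum_v w x v * (T x v)%:R.
have sumN (u : V -> R) : \sum_v u v = 1 ->
    \sum_v u v * (~~ T x v)%:R = 1 - \sum_v u v * (T x v)%:R.
  move=> u1; rewrite -[X in X - _]u1 -sumrB; apply: eq_bigr => v _.
  by case: (T x v); rewrite /= ?mulr1 ?mulr0 ?subrr ?subr0.
have sum01 (u : V -> R) : is_pmf u -> 0 <= \sum_v u v * (T x v)%:R <= 1.
  move=> [u0 u1]; rewrite sumr_ge0 /= => [|v _]; last by rewrite mulr_ge0.
  rewrite -[leRHS]u1; apply: ler_sum => v _.
  by case: (T x v); rewrite ?mulr1 ?mulr0.
(* Here K = M.+1 / L, and the density bound gives al <= L s, that is K al <= s M.+1. *)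
rewrite !sumN // ?(hw x).2 // -[L / _]invf_div.
apply: expr1B_le.
- exact: sum01 (hw x).
- by have /andP[] := sum01 r (conj r0 r1).
- by rewrite divr_gt0 ?ltr0n.
rewrite mulrAC [leRHS]mulrC -mulrA ler_wpM2l // ler_pdivrMr //.
rewrite mulr_suml; apply: ler_sum => v _.
have [/wT h|_] := boolP (T x v); last by rewrite !mulr0 mul0r.
by rewrite !mulr1 mulrC.
Qed.

End Covering.

(** * A two-stage covering code on arbitrary finite alphabets *)

Section OneShot.
Context {R : realType} {X1 X2 Y V1 V2 : finType}.
Variables (p : X1 -> X2 -> R) (W : X2 -> Y -> R) (w1 : X1 -> V1 -> R)
  (w2 : V1 * X2 -> V2 -> R) (r1 : V1 -> R) (r2 : V1 -> V2 -> R).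
Hypotheses (p0 : forall x1 x2, 0 <= p x1 x2) (p1 : \sum_x1 \sum_x2 p x1 x2 = 1)
  (hW : is_kernel W) (hw1 : is_kernel w1) (hw2 : is_kernel w2)
  (hr1 : is_pmf r1) (hr2 : is_kernel r2).
Variables (G1 : X1 -> V1 -> bool) (G2 : V1 * X2 -> V2 -> bool)
  (G3 : Y -> V1 -> V2 -> bool) (L1 L2 eta : R) (M1 M2 : nat).
Hypotheses (L1_gt0 : 0 < L1) (L2_gt0 : 0 < L2) (eta_gt0 : 0 < eta)
  (wG1 : forall x1 v1, G1 x1 v1 -> w1 x1 v1 <= L1 * r1 v1)
  (wG2 : forall v1 x2 v2, G2 (v1, x2) v2 -> w2 (v1, x2) v2 <= L2 * r2 v1 v2).

Let prob (E : X1 -> X2 -> Y -> V1 -> V2 -> bool) : R :=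
  \sum_x1 \sum_x2 \sum_y \sum_v1 \sum_v2
    p x1 x2 * W x2 y * w1 x1 v1 * w2 (v1, x2) v2 * (E x1 x2 y v1 v2)%:R.

(* [T1] and [T2] ask for a density bound and for a small conditional probability
   that a later stage fails. This takes over the role of joint typicality and of
   the Markov lemma. *)
Let beta x2 v1 v2 : R := \sum_y W x2 y * (~~ G3 y v1 v2)%:R.
Let T2 v1 x2 v2 := G2 (v1, x2) v2 && (beta x2 v1 v2 <= eta).
Let err2 v1 x2 : R := \sum_v2 w2 (v1, x2) v2 * (~~ T2 v1 x2 v2)%:R + L2 / M2.+1%:R.
Let phi x1 v1 : R := \sum_x2 p x1 x2 * err2 v1 x2.
Let px1 x1 : R := \sum_x2 p x1 x2.
Let T1 x1 v1 := G1 x1 v1 && (phi x1 v1 <= eta * px1 x1).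

Let beta_ge0 x2 v1 v2 : 0 <= beta x2 v1 v2.
Proof. by apply: sumr_ge0 => y _; rewrite mulr_ge0 // (hW _).1. Qed.

Let beta_le1 x2 v1 v2 : beta x2 v1 v2 <= 1.
Proof.
rewrite -(hW x2).2; apply: ler_sum => y _.
by case: (G3 _ _ _); rewrite /= ?mulr0 ?mulr1 // (hW _).1.
Qed.

Let prob1 : prob (fun x1 _ _ v1 _ => ~~ G1 x1 v1) =
  \sum_x1 \sum_v1 px1 x1 * w1 x1 v1 * (~~ G1 x1 v1)%:R.
Proof.
apply: eq_bigr => x1 _.
transitivity (\sum_x2 \sum_v1 p x1 x2 * w1 x1 v1 * (~~ G1 x1 v1)%:R).
  apply: eq_bigr => x2 _; rewrite exchange_big; apply: eq_bigr => v1 _ /=.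
  transitivity (\sum_y W x2 y * (p x1 x2 * w1 x1 v1 * (~~ G1 x1 v1)%:R)).
    apply: eq_bigr => y _; rewrite -mulr_suml -mulr_sumr (hw2 _).2; ring.
  by rewrite -mulr_suml (hW _).2 mul1r.
by rewrite exchange_big; apply: eq_bigr => v1 _; rewrite /px1 !mulr_suml.
Qed.

Let prob2 : prob (fun _ x2 _ v1 v2 => ~~ G2 (v1, x2) v2) =
  \sum_x1 \sum_v1 w1 x1 v1 * \sum_x2 p x1 x2 * \sum_v2 w2 (v1, x2) v2 *
    (~~ G2 (v1, x2) v2)%:R.
Proof.
apply: eq_bigr => x1 _; under [RHS]eq_bigr do rewrite mulr_sumr.
rewrite [RHS]exchange_big; apply: eq_bigr => x2 _.
rewrite exchange_big; apply: eq_bigr => v1 _ /=.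
transitivity (\sum_y W x2 y * (w1 x1 v1 * (p x1 x2 * \sum_v2 w2 (v1, x2) v2 *
    (~~ G2 (v1, x2) v2)%:R))).
  apply: eq_bigr => y _; rewrite !mulr_sumr; apply: eq_bigr => v2 _; ring.
by rewrite -mulr_suml (hW _).2 mul1r.
Qed.

Let prob3 : prob (fun _ _ y v1 v2 => ~~ G3 y v1 v2) =
  \sum_x1 \sum_v1 w1 x1 v1 * \sum_x2 p x1 x2 * \sum_v2 w2 (v1, x2) v2 *
    beta x2 v1 v2.
Proof.
apply: eq_bigr => x1 _; under [RHS]eq_bigr do rewrite mulr_sumr.
rewrite [RHS]exchange_big; apply: eq_bigr => x2 _.
rewrite exchange_big; apply: eq_bigr => v1 _ /=.
rewrite exchange_big !mulr_sumr; apply: eq_bigr => v2 _ /=.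
rewrite /beta !mulr_sumr; apply: eq_bigr => y _; ring.
Qed.

(** Union bound for the two ways of leaving [T2]; exceeding the threshold on [beta] is charged by
    Markov's inequality in pointwise form, at the price [eta^-1]. *)
Let phi_bound : \sum_x1 \sum_v1 w1 x1 v1 * phi x1 v1 <=
  prob (fun _ x2 _ v1 v2 => ~~ G2 (v1, x2) v2) + L2 / M2.+1%:R +
  eta^-1 * prob (fun _ _ y v1 v2 => ~~ G3 y v1 v2).
Proof.
have eL : L2 / M2.+1%:R = \sum_x1 \sum_v1 w1 x1 v1 * \sum_x2 p x1 x2 *
    (L2 / M2.+1%:R).
  rewrite -[LHS]mul1r -p1 mulr_suml; apply: eq_bigr => x1 _.
  by rewrite -mulr_suml (hw1 _).2 mul1r mulr_suml.
rewrite eL prob2 prob3 mulr_sumr -!big_split /=; apply: ler_sum => x1 _.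
rewrite mulr_sumr -!big_split /=; apply: ler_sum => v1 _.
rewrite [eta^-1 * _]mulrCA -!mulrDr ler_wpM2l ?(hw1 _).1 //.
rewrite mulr_sumr -!big_split /=; apply: ler_sum => x2 _.
rewrite [eta^-1 * _]mulrCA -!mulrDr ler_wpM2l //.
rewrite /err2 -addrA [leRHS]addrCA [leLHS]addrC lerD2l.
rewrite mulr_sumr -big_split /=; apply: ler_sum => v2 _.
rewrite [eta^-1 * _]mulrCA -!mulrDr ler_wpM2l ?(hw2 _).1 // /T2.
have bp : 0 <= eta^-1 * beta x2 v1 v2 by rewrite mulr_ge0 // invr_ge0 ltW.
case: (G2 _ _) => /=; last by rewrite lerDl.
rewrite add0r; have [//|be] := leP (beta x2 v1 v2) eta.
by rewrite /= ler_pdivlMl // mulr1 ltW.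
Qed.

Let px1_ge0 x1 : 0 <= px1 x1.
Proof. by apply: sumr_ge0. Qed.

Let err2_ge0 v1 x2 : 0 <= err2 v1 x2.
Proof.
rewrite addr_ge0 ?divr_ge0 // ?(ltW L2_gt0) // sumr_ge0 // => v2 _.
by rewrite mulr_ge0 // (hw2 _).1.
Qed.

(** The same argument one stage earlier. Since [phi] is compared with [eta * px1] instead of being
    normalised, source letters of probability 0 need no separate case. *)
Let T1_bound :
  \sum_x1 px1 x1 * (\sum_v1 w1 x1 v1 * (~~ T1 x1 v1)%:R + L1 / M1.+1%:R) <=
  prob (fun x1 _ _ v1 _ => ~~ G1 x1 v1) + L1 / M1.+1%:R +
  eta^-1 * \sum_x1 \sum_v1 w1 x1 v1 * phi x1 v1.
Proof.
have -> : L1 / M1.+1%:R = \sum_x1 px1 x1 * (L1 / M1.+1%:R).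
  by rewrite -mulr_suml p1 mul1r.
rewrite prob1 mulr_sumr -!big_split /=; apply: ler_sum => x1 _.
rewrite -mulr_suml p1 mul1r mulrDr -addrA [leRHS]addrCA [leLHS]addrC lerD2l.
rewrite !mulr_sumr -big_split /=; apply: ler_sum => v1 _.
have -> : px1 x1 * w1 x1 v1 * (~~ G1 x1 v1)%:R + eta^-1 * (w1 x1 v1 * phi x1 v1) =
   w1 x1 v1 * (px1 x1 * (~~ G1 x1 v1)%:R + eta^-1 * phi x1 v1) by ring.
rewrite mulrCA ler_wpM2l ?(hw1 _).1 // /T1.
have ph : 0 <= eta^-1 * phi x1 v1.
  rewrite mulr_ge0 ?invr_ge0 ?(ltW eta_gt0) // sumr_ge0 // => x2 _.
  by rewrite mulr_ge0.
case: (G1 _ _) => /=; last by rewrite lerDl.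
rewrite mulr0 add0r; have [_|be] := leP (phi x1 v1) _; first by rewrite mulr0.
by rewrite mulr1 ler_pdivlMl // ltW.
Qed.

(** There are three sources of failure: encoder 1 misses [T1], which the first covering bounds;
    encoder 2 misses [T2] although encoder 1 succeeded, which [T1] bounds by [eta]; and [G3] fails
    although both succeeded, which [T2] bounds by [eta]. *)
Lemma one_shot_code : exists (c1 : 'I_M1.+1 -> V1) (f1 : X1 -> 'I_M1.+1)
    (c2 : 'I_M1.+1 -> 'I_M2.+1 -> V2) (f2 : 'I_M1.+1 -> X2 -> 'I_M2.+1),
  \sum_x1 \sum_x2 \sum_y p x1 x2 * W x2 y *
    (~~ G3 y (c1 (f1 x1)) (c2 (f1 x1) (f2 (f1 x1) x2)))%:R <=
  prob (fun x1 _ _ v1 _ => ~~ G1 x1 v1) + L1 / M1.+1%:R +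
  eta^-1 * (prob (fun _ x2 _ v1 v2 => ~~ G2 (v1, x2) v2) + L2 / M2.+1%:R +
            eta^-1 * prob (fun _ _ y v1 v2 => ~~ G3 y v1 v2)) + 2 * eta.
Proof.
have T1w x1 v1 : T1 x1 v1 -> w1 x1 v1 <= L1 * r1 v1 by case/andP => /wG1.
have [c1 [f1 cov1]] := covering M1 px1_ge0 hr1 hw1 L1_gt0 T1w.
(* Mass of x2 over the x1 that encoder 1 sends successfully to i. It is neither normalised nor p(x2
   | v1), hence the arbitrary weights in [covering]. *)
pose a i x2 : R := \sum_x1 p x1 x2 * ((f1 x1 == i) && T1 x1 (c1 i))%:R.
have a0 i x2 : 0 <= a i x2 by apply: sumr_ge0 => x1 _; rewrite mulr_ge0.
have T2w i x2 v2 : T2 (c1 i) x2 v2 -> w2 (c1 i, x2) v2 <= L2 * r2 (c1 i) v2.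
  by case/andP => /wG2.
have hw2' i : is_kernel (fun x2 => w2 (c1 i, x2)) by [].
have /choice [c2 /choice [f2 cov2]] i :=
  covering M2 (a0 i) (hr2 (c1 i)) (hw2' i) L2_gt0 (@T2w i).
exists c1, f1, c2, f2.
pose bad1 x1 := ~~ T1 x1 (c1 (f1 x1)).
pose bad2 x1 x2 := T1 x1 (c1 (f1 x1)) &&
  ~~ T2 (c1 (f1 x1)) x2 (c2 (f1 x1) (f2 (f1 x1) x2)).
apply: (@le_trans _ _ (\sum_x1 px1 x1 * (bad1 x1)%:R +
  \sum_x1 \sum_x2 p x1 x2 * (bad2 x1 x2)%:R + eta)).
  have -> : eta = \sum_x1 \sum_x2 p x1 x2 * eta.
    rewrite -[LHS]mul1r -p1 mulr_suml; apply: eq_bigr => x1 _.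
    by rewrite mulr_suml.
  rewrite -!big_split /=; apply: ler_sum => x1 _.
  rewrite /px1 mulr_suml -!big_split /=; apply: ler_sum => x2 _.
  under eq_bigr do rewrite -mulrA.
  rewrite -mulr_sumr -!mulrDr ler_wpM2l //.
  rewrite -/(beta x2 (c1 (f1 x1)) (c2 (f1 x1) (f2 (f1 x1) x2))) /bad1 /bad2.
  case: (T1 _ _) => /=; last first.
    by rewrite addr0 (le_trans (beta_le1 _ _ _)) // lerDl ltW.
  rewrite add0r; case: (boolP (T2 _ _ _)) => [/andP[_ be]|_] /=.
    by rewrite add0r.
  by rewrite (le_trans (beta_le1 _ _ _)) // lerDl ltW.
have -> : 2 * eta = eta + eta by ring.
rewrite [leRHS]addrA lerD2r; apply: lerD.
  apply: le_trans cov1 _; apply: le_trans T1_bound _.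
  by rewrite lerD2l ler_wpM2l ?phi_bound // invr_ge0 ltW.
have -> : \sum_x1 \sum_x2 p x1 x2 * (bad2 x1 x2)%:R =
    \sum_i \sum_x2 a i x2 * (~~ T2 (c1 i) x2 (c2 i (f2 i x2)))%:R.
  rewrite [RHS]exchange_big [LHS]exchange_big; apply: eq_bigr => x2 _ /=.
  under [RHS]eq_bigr do rewrite mulr_suml.
  rewrite [RHS]exchange_big; apply: eq_bigr => x1 _ /=.
  rewrite (bigD1 (f1 x1)) //= eqxx /= big1 ?addr0 => [|i].
    by rewrite /bad2 -mulrA -natrM mulnb.
  by rewrite eq_sym => /negbTE ->; rewrite mulr0 mul0r.
apply: (@le_trans _ _ (\sum_i \sum_x2 a i x2 * err2 (c1 i) x2)).
  by apply: ler_sum => i _; apply: cov2.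
(* Regrouping by x1 makes [phi] appear at the codeword actually sent, where [T1] controls it. *)
have -> : \sum_i \sum_x2 a i x2 * err2 (c1 i) x2 =
    \sum_x1 phi x1 (c1 (f1 x1)) * (T1 x1 (c1 (f1 x1)))%:R.
  transitivity (\sum_i \sum_x1 ((f1 x1 == i) && T1 x1 (c1 i))%:R * phi x1 (c1 i)).
    apply: eq_bigr => i _; under eq_bigr do rewrite mulr_suml.
    rewrite exchange_big; apply: eq_bigr => x1 _; rewrite /phi mulr_sumr.
    by apply: eq_bigr => x2 _; ring.
  rewrite exchange_big; apply: eq_bigr => x1 _ /=.
  rewrite (bigD1 (f1 x1)) //= eqxx /= big1 ?addr0 => [|i]; first by rewrite mulrC.
  by rewrite eq_sym => /negbTE ->; rewrite mul0r.
have -> : eta = \sum_x1 eta * px1 x1 by rewrite -mulr_sumr p1 mulr1.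
apply: ler_sum => x1 _; case: (boolP (T1 _ _)) => [/andP[_]|_]; first by rewrite mulr1.
by rewrite mulr0 mulr_ge0 // ltW.
Qed.

End OneShot.

Section MutualInfoBound.
Context {R : realType}.

(* Gibbs' inequality against the reference channel [(r + law p Y) / 2], whose
   density with respect to [law p Y] is never below [1 / 2]. *)
Lemma mutual_info_ge (W B K : finType) (p : W -> R) (Y : W -> B) (C : W -> K)
    (r : K -> B -> R) (t : R) :
  is_pmf p -> is_kernel r -> 0 < t ->
  (1 - \sum_w p w * (~~ (t * law p Y (Y w) <= r (C w) (Y w)))%:R) * log2 t - 1
    <= mutual_info p Y C.
Proof.
move=> [p0 p1] hr t0; rewrite mutual_infoE.
pose r' (cy : K * B) := (r cy.1 cy.2 + law p Y cy.2) / 2.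
pose good w := t * law p Y (Y w) <= r (C w) (Y w).
have r'_sum : \sum_(cy : K * B) law p C cy.1 * r' cy = 1.
  rewrite sum_prod /r' /=; under eq_bigr do rewrite -mulr_sumr -mulr_suml big_split
    /= (hr _).2 sum_law p1.
  by rewrite -mulr_suml sum_law p1; field.
have r'_ge0 cy : 0 <= r' cy by rewrite divr_ge0 // addr_ge0 ?(hr _).1 // law_ge0.
apply: (@le_trans _ _ (\sum_w p w * ((good w)%:R * log2 t - 1))).
  under [leRHS]eq_bigr do rewrite mulrBr mulr1 mulrA.
  rewrite sumrB p1 lerD2r -mulr_suml.
  have -> : 1 - \sum_w p w * (~~ good w)%:R = \sum_w p w * (good w)%:R; last by [].
  rewrite -[X in X - _]p1 -sumrB; apply: eq_bigr => w _.
  by case: (good w); rewrite /= ?mulr1 ?mulr0 ?subr0 ?subrr.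
(* The second summand is the tangent bound for the ratio of the true joint law to the one that [r']
   induces, and its mean is nonnegative. The first is at least log2 t - 1 on good points, and at
   least -1 elsewhere. *)
apply: (@le_trans _ _ (\sum_w p w * (log2 (r' (C w, Y w) / law p Y (Y w)) +
   (1 - law p C (C w) * r' (C w, Y w) / law p [% C, Y] (C w, Y w)) / ln 2))).
  under [leRHS]eq_bigr do rewrite mulrDr.
  rewrite big_split /=.
  apply: (@le_trans _ _ (\sum_w p w * log2 (r' (C w, Y w) / law p Y (Y w)) + 0)).
    rewrite addr0; apply: ler_sum => w _.
    have [->|pw] := eqVneq (p w) 0; first by rewrite !mul0r.
    apply: ler_wpM2l => //; have Y0 := law_gt0 p0 Y pw.
    have log2_half : log2 2^-1 = - 1 :> R.
      by rewrite log2V // /log2 divff // gt_eqF // ln2_gt0.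
    rewrite /r' /=; case: (boolP (good w)) => [gw|_].
      rewrite mul1r -log2_half -log2M // log2_le ?divr_gt0 //.
      rewrite ler_pdivlMr // mulrAC ler_pM2r ?invr_gt0 //.
      by apply: le_trans gw _; rewrite lerDl ltW.
    rewrite mul0r add0r -log2_half log2_le // ler_pdivlMr // mulrC.
    by rewrite ler_pM2r ?invr_gt0 // lerDr (hr _).1.
  rewrite lerD2l.
  under eq_bigr do rewrite mulrA mulrBr mulr1.
  rewrite -mulr_suml divr_ge0 ?(ltW ln2_gt0) // sumrB subr_ge0 p1.
  rewrite -(expect_law p [% C, Y] (fun cy => law p C cy.1 * r' cy /
    law p [% C, Y] cy)) -[leRHS]r'_sum.
  apply: ler_sum => cy _; have [->|q0] := eqVneq (law p [% C, Y] cy) 0.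
    by rewrite mul0r mulr_ge0 // law_ge0.
  by rewrite mulrC divfK.
apply: ler_sum => w _; have [->|pw] := eqVneq (p w) 0; first by rewrite !mul0r.
apply: ler_wpM2l => //.
have Y0 := law_gt0 p0 Y pw; have C0 := law_gt0 p0 C pw.
have YC0 := law_gt0 p0 [% C, Y] pw.
have -> : law p [% Y, C] (Y w, C w) = law p [% C, Y] (C w, Y w).
  by apply: eq_law => w'; rewrite /rv_pair !xpair_eqE andbC.
have r0 : 0 < r' (C w, Y w).
  by rewrite divr_gt0 // ltr_wpDl // (hr _).1.
set u := law p [% C, Y] _ in YC0 *; set z := law p C _ in C0 *.
set y := law p Y _ in Y0 *; set v := r' _ in r0 *.
have -> : u / (y * z) = v / y * (u / (z * v)).
  by field; rewrite !gt_eqF.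
have vy0 : 0 < v / y by exact: divr_gt0.
have uzv0 : 0 < u / (z * v) by apply: divr_gt0 => //; exact: mulr_gt0.
rewrite [leRHS](log2M vy0 uzv0) lerD2l.
by have := log2_ge_1BV uzv0; rewrite invf_div.
Qed.

End MutualInfoBound.

(** * Product laws and exponential deviation bounds *)

Section Iid.
Context {R : realType}.

Lemma sum_ffun_prod (T : finType) n (F : 'I_n -> T -> R) :
  \sum_(f : {ffun 'I_n -> T}) \prod_i F i (f i) = \prod_i \sum_t F i t.
Proof. by rewrite bigA_distr_bigA. Qed.

Lemma iid_pmfP (T : finType) (p : T -> R) n : is_pmf p -> is_pmf (iid_pmf p (n := n)).
Proof.
move=> [p0 p1]; split=> [s|]; first by apply: prodr_ge0.
by rewrite /iid_pmf (sum_ffun_prod (fun=> p)) big1.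
Qed.

Definition iid_kernel (A C : finType) (k : A -> C -> R) n
    (a : {ffun 'I_n -> A}) (c : {ffun 'I_n -> C}) : R := \prod_i k (a i) (c i).

Lemma iid_kernelP (A C : finType) (k : A -> C -> R) n :
  is_kernel k -> is_kernel (iid_kernel k (n := n)).
Proof.
move=> hk a; split=> [c|]; first by apply: prodr_ge0 => i _; apply: (hk _).1.
rewrite /iid_kernel (sum_ffun_prod (fun i => k (a i))) big1 // => i _.
exact: (hk _).2.
Qed.

Lemma law_map_seq (T A : finType) (p : T -> R) (X : T -> A) n a :
  law (iid_pmf p (n := n)) (map_seq X (n := n)) a = \prod_i law p X (a i).
Proof.
under [RHS]eq_bigr do rewrite lawE.
rewrite -(sum_ffun_prod (fun i t => p t * (X t == a i)%:R)) lawE.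
apply: eq_bigr => s _; rewrite big_split /=; congr (_ * _).
have [<-|sa] := eqVneq (map_seq X s) a.
  by rewrite big1 // => i _; rewrite ffunE eqxx.
have [i si] : exists i, X (s i) != a i.
  apply/existsP; apply: contraNT sa; rewrite negb_exists => /forallP sa.
  by apply/eqP/ffunP => i; rewrite ffunE; apply/eqP; have := sa i; rewrite negbK.
by rewrite (bigD1 i) //= (negbTE si) mul0r.
Qed.

(** Passes from words of pairs, on which product laws live, to pairs of words, which the one-shot
    code takes. *)
Lemma big_ffun_pair (A C : finType) n (F : {ffun 'I_n -> A} -> {ffun 'I_n -> C} -> R) :
  \sum_(s : {ffun 'I_n -> A * C}) F (map_seq fst s) (map_seq snd s) =
  \sum_a \sum_c F a c.
Proof.
rewrite pair_bigA /=.
rewrite (reindex (fun ac : {ffun 'I_n -> A} * {ffun 'I_n -> C} =>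
  [ffun i => (ac.1 i, ac.2 i)])) /=; last first.
  exists (fun s => (map_seq fst s, map_seq snd s)) => [[a c]|s] _ /=.
    by congr (_, _); apply/ffunP => i; rewrite !ffunE.
  by apply/ffunP => i; rewrite !ffunE -surjective_pairing.
apply: eq_bigr => -[a c] _ /=.
by congr (F _ _); apply/ffunP => i; rewrite !ffunE.
Qed.

Lemma expR_le_quadratic (x : R) : x <= 2^-1 -> expR x <= 1 + x + 2 * x ^+ 2.
Proof.
move=> x2; have x1 : 0 < 1 - x by lra.
apply: (@le_trans _ _ (1 - x)^-1).
  by rewrite -[x in expR x]opprK expRN lef_pV2 ?posrE ?expR_gt0 ?expR_ge1Dx.
rewrite -[_^-1]mul1r ler_pdivrMr // -subr_ge0.
have -> : (1 + x + 2 * x ^+ 2) * (1 - x) - 1 = x ^+ 2 * (1 - 2 * x) by ring.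
by rewrite mulr_ge0 ?sqr_ge0 //; lra.
Qed.

(** The moment generating function is 1 at 0, with the negative mean as its slope there, so it dips
    below 1 to the right of 0. *)
Lemma exponential_tilt (T : finType) (q g : T -> R) :
  is_pmf q -> \sum_t q t * g t < 0 ->
  exists2 l, 0 < l & \sum_t q t * expR (l * g t) < 1.
Proof.
move=> [q0 q1]; set m := \sum_t _ => m0.
pose D := \sum_t `|g t| + 1.
have D0 : 0 < D by rewrite ltr_wpDl // sumr_ge0.
have gD t : `|g t| <= D.
  by rewrite /D (bigD1 t) //= -addrA lerDl addr_ge0 // sumr_ge0.
have mD : - m <= D.
  rewrite -[D]mul1r -q1 mulr_suml /m -sumrN; apply: ler_sum => t _.
  rewrite -mulrN ler_wpM2l // (le_trans _ (gD t)) //.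
  by rewrite -normrN ler_norm.
(* With this choice the quadratic term 2 (l D)^2 is half of - l m, and - m <= D keeps l D below 1 /
   4, in the range of [expR_le_quadratic]. *)
pose l := - m / (4 * D ^+ 2).
have l0 : 0 < l by rewrite divr_gt0 ?oppr_gt0 // mulr_gt0 // exprn_gt0.
have lD : l * D <= 4^-1.
  have -> : l * D = - m / (4 * D) by rewrite /l; field; rewrite gt_eqF.
  by rewrite ler_pdivrMr ?mulr_gt0 // mulrA mulVf // mul1r.
exists l => //.
apply: (@le_lt_trans _ _ (\sum_t q t * (1 + l * g t + 2 * (l * D) ^+ 2))).
  apply: ler_sum => t _; apply: ler_wpM2l => //.
  have lg : `|l * g t| <= l * D by rewrite normrM gtr0_norm // ler_pM2l.
  apply: le_trans (expR_le_quadratic _) _.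
    by apply: le_trans (ler_norm _) _; apply: le_trans lg _; lra.
  rewrite lerD2l ler_pM2l // -(real_normK (num_real (l * g t))).
  by apply: lerXn2r; rewrite ?nnegrE // mulr_ge0 // ltW.
have -> : \sum_t q t * (1 + l * g t + 2 * (l * D) ^+ 2) =
    1 + l * m + 2 * (l * D) ^+ 2.
  under eq_bigr do rewrite 2!mulrDr mulr1 [q _ * (l * _)]mulrCA.
  by rewrite !big_split /= -mulr_suml -mulr_sumr q1 mul1r.
have -> : 2 * (l * D) ^+ 2 = l * (- m / 2).
  by rewrite /l; field; rewrite gt_eqF.
have : l * m < 0 by rewrite pmulr_rlt0.
lra.
Qed.

(** Chernoff's bound: on the deviation event the sum of the [g (s i)] is positive, so its indicator
    is at most the exponential of [l] times this sum, whose mean factors over the coordinates. *)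
Lemma likelihood_ratio_deviation (T : finType) (q num den : T -> R) (b : R) :
  is_pmf q -> (forall t, q t != 0 -> 0 < num t) ->
  (forall t, q t != 0 -> 0 < den t) -> 0 < b ->
  \sum_t q t * log2 (num t / den t) < log2 b ->
  exists2 rho, 0 <= rho < 1 & forall n,
    \sum_(s : {ffun 'I_n -> T}) iid_pmf q s *
      (~~ (\prod_i num (s i) <= b ^+ n * \prod_i den (s i)))%:R <= rho ^+ n.
Proof.
move=> [q0 q1] num0 den0 b0 mean.
pose g t := ln (num t / den t) - ln b.
have [|l l0 tilt] := @exponential_tilt _ q g (conj q0 q1).
  rewrite /g; under eq_bigr do rewrite mulrBr.
  rewrite sumrB -mulr_suml q1 mul1r subr_lt0.
  rewrite -(ltr_pM2r (x := (ln 2)^-1)) ?invr_gt0 ?ln2_gt0 //.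
  by rewrite mulr_suml; under eq_bigr do rewrite -mulrA.
exists (\sum_t q t * expR (l * g t)).
  by rewrite tilt andbT sumr_ge0 // => t _; rewrite mulr_ge0 ?expR_ge0.
move=> n; rewrite -[n in leRHS]card_ord -prodr_const.
rewrite -(sum_ffun_prod (fun _ t => q t * expR (l * g t))).
apply: ler_sum => s _; rewrite big_split /=.
have q_ge0 : 0 <= \prod_i q (s i) by apply: prodr_ge0.
have [q_eq0|q_neq0] := eqVneq (\prod_i q (s i)) 0.
  by rewrite /iid_pmf q_eq0 !mul0r.
have qs i : q (s i) != 0.
  by apply: contraNneq q_neq0 => qi; rewrite (bigD1 i) //= qi mul0r.
apply: ler_wpM2l => //.
case: (leP (\prod_i num (s i)) _) => [_|dev].
  by apply: prodr_ge0 => i _; apply: expR_ge0.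
apply: (@le_trans _ _ (expR 0)); first by rewrite expR0.
rewrite -expR_sum -mulr_sumr ler_expR mulr_ge0 ?(ltW l0) //.
rewrite -ler_expR expR0 -(ler_pM2r (x := b ^+ n * \prod_i den (s i))); last first.
  by rewrite mulr_gt0 ?exprn_gt0 // prodr_gt0 // => i _; apply: den0.
rewrite mul1r; apply: le_trans (ltW dev) _.
rewrite expR_sum -[n in b ^+ n]card_ord -prodr_const -!big_split /=.
apply: ler_prod => i _.
rewrite (ltW (num0 _ (qs i))) /g expRB !lnK ?posrE ?divr_gt0 ?num0 ?den0 //=.
by rewrite mulrA divfK ?gt_eqF // divfK // gt_eqF // den0.
Qed.

End Iid.

(** * Block codes from the one-shot code *)

Section Achievability.
Context {R : realType}.

Lemma powR2X (a : R) n : (2 `^ a) ^+ n = 2 `^ (a * n%:R).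
Proof. by rewrite powRrM powR_mulrn // powR_ge0. Qed.

Lemma geometric_le (rho c : R) : 0 <= rho < 1 -> 0 < c ->
  exists N, forall n, (N < n)%N -> rho ^+ n <= c.
Proof.
move=> /andP[r0 r1] c0.
have : ((fun n => rho ^+ n) @ \oo --> (0 : R))%classic by apply: cvg_expr; rewrite ger0_norm.
move=> /cvgr0Pnorm_lt /(_ c c0) [N _ HN]; exists N => n Nn.
apply: ltW; apply: le_lt_trans (ler_norm _) _; apply: HN; exact: ltnW.
Qed.

(** The size is the integer part of 2^x, at least 1 as x >= 0; rounding loses at most a factor 2. *)
Lemma codebook_size (x : R) : 0 <= x ->
  exists M : nat, log2 M.+1%:R <= x /\ 2 `^ x <= 2 * M.+1%:R.
Proof.
move=> x0; have y1 : 1 <= 2 `^ x :> R by rewrite -[leLHS](powRr0 2) ler_powR // ler1n.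
have /andP[lo hi] := truncn_itv (le_trans ler01 y1).
set N := Num.truncn _ in lo hi.
have N0 : (0 < N)%N by rewrite truncn_gt0.
exists N.-1; rewrite prednK //; split.
  by rewrite -[leRHS]log2_powR log2_le // ltr0n.
apply: (le_trans (ltW hi)); rewrite -natrM ler_nat; lia.
Qed.

Lemma big_ffun3 (A1 A2 B : finType) n
    (F : {ffun 'I_n -> A1} -> {ffun 'I_n -> A2} -> {ffun 'I_n -> B} -> R) :
  \sum_(s : {ffun 'I_n -> A1 * A2 * B})
    F (map_seq (@src_X1 A1 A2 B) s) (map_seq (@src_X2 A1 A2 B) s)
      (map_seq (@src_Y A1 A2 B) s) =
  \sum_x1 \sum_x2 \sum_y F x1 x2 y.
Proof.
rewrite -big_ffun_pair.
rewrite -(big_ffun_pair (fun s y => F (map_seq fst s) (map_seq snd s) y)) /=.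
by apply: eq_bigr => s _; congr (F _ _ _); apply/ffunP => i; rewrite !ffunE.
Qed.

Lemma big_ffun5 (A1 A2 B C1 C2 : finType) n
    (F : {ffun 'I_n -> A1} -> {ffun 'I_n -> A2} -> {ffun 'I_n -> B} ->
         {ffun 'I_n -> C1} -> {ffun 'I_n -> C2} -> R) :
  \sum_(s : {ffun 'I_n -> A1 * A2 * B * C1 * C2})
    F (map_seq rv_X1 s) (map_seq rv_X2 s) (map_seq rv_Y s)
      (map_seq rv_V1 s) (map_seq rv_V2 s) =
  \sum_x1 \sum_x2 \sum_y \sum_v1 \sum_v2 F x1 x2 y v1 v2.
Proof.
rewrite -(big_ffun3 (fun x1 x2 y => \sum_v1 \sum_v2 F x1 x2 y v1 v2)).
rewrite -(big_ffun_pair (fun s v1 => \sum_v2 F (map_seq (@src_X1 A1 A2 B) s)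
  (map_seq (@src_X2 A1 A2 B) s) (map_seq (@src_Y A1 A2 B) s) v1 v2)) /=.
rewrite -(big_ffun_pair (fun s v2 => F (map_seq (@src_X1 A1 A2 B) (map_seq fst s))
  (map_seq (@src_X2 A1 A2 B) (map_seq fst s))
  (map_seq (@src_Y A1 A2 B) (map_seq fst s)) (map_seq snd s) v2)) /=.
by apply: eq_bigr => s _; congr (F _ _ _ _ _); apply/ffunP => i; rewrite !ffunE.
Qed.

Context {A1 A2 B : finType}.
Variable p : A1 * A2 * B -> R.
Hypothesis hp : is_pmf p.
Hypothesis hM : markov_chain p (@src_X1 A1 A2 B) (@src_X2 A1 A2 B)
  (@src_Y A1 A2 B).

Section Kernels.
Context {C1 C2 : finType}.
Variables (w1 : A1 -> C1 -> R) (w2 : C1 * A2 -> C2 -> R).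
Hypotheses (hw1 : is_kernel w1) (hw2 : is_kernel w2).

Let q := joint_of p w1 w2.
Let hq : is_pmf q. Proof. exact: joint_of_pmf. Qed.
Let r1 := law q rv_V1.
Let r2 := kernel_of q rv_V1 rv_V2.
Let r3 := kernel_of q [% rv_V1, rv_V2] rv_Y.
Let pY := law p (@src_Y A1 A2 B).
Let p12 := law p (fun s => s.1).
Let W := kernel_of p (@src_X2 A1 A2 B) (@src_Y A1 A2 B).
Let hW : is_kernel W. Proof. exact: kernel_ofP. Qed.
Let hr3 : is_kernel r3. Proof. exact: kernel_ofP. Qed.

Let gt0_neq (x : R) : 0 <= x -> x != 0 -> 0 < x.
Proof. by move=> x0 xn; rewrite lt_def xn. Qed.

Let w1_gt0 w : q w != 0 -> 0 < w1 (rv_X1 w) (rv_V1 w).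
Proof.
move=> qw; apply: gt0_neq; first exact: (hw1 _).1.
by apply: contraNneq qw; rewrite /q /joint_of /rv_X1 /rv_V1 => ->; rewrite mulr0 mul0r.
Qed.

Let w2_gt0 w : q w != 0 -> 0 < w2 (rv_V1 w, rv_X2 w) (rv_V2 w).
Proof.
move=> qw; apply: gt0_neq; first exact: (hw2 _).1.
by apply: contraNneq qw; rewrite /q /joint_of /rv_X2 /rv_V1 /rv_V2 => ->; rewrite mulr0.
Qed.

Let r1_gt0 w : q w != 0 -> 0 < r1 (rv_V1 w).
Proof. exact: (law_gt0 hq.1). Qed.

Let r2_gt0 w : q w != 0 -> 0 < r2 (rv_V1 w) (rv_V2 w).
Proof.
move=> qw; have := law_gt0 hq.1 [% rv_V1, rv_V2] qw.
by rewrite -(kernel_ofE _ _ hq) pmulr_rgt0 // (law_gt0 hq.1).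
Qed.

Let r3_gt0 w : q w != 0 -> 0 < r3 (rv_V1 w, rv_V2 w) (rv_Y w).
Proof.
move=> qw; have := law_gt0 hq.1 [% [% rv_V1, rv_V2], rv_Y] qw.
by rewrite -(kernel_ofE _ _ hq) pmulr_rgt0 // (law_gt0 hq.1 [% rv_V1, rv_V2]).
Qed.

Let pYE y : pY y = law q rv_Y y.
Proof. by symmetry; exact: (joint_of_law_source p hw1 hw2). Qed.

Let pY_gt0 w : q w != 0 -> 0 < pY (rv_Y w).
Proof. by rewrite pYE; apply: (law_gt0 hq.1). Qed.

Let mean1 : \sum_w q w * log2 (w1 (rv_X1 w) (rv_V1 w) / r1 (rv_V1 w)) =
  mutual_info q rv_X1 rv_V1.
Proof.
rewrite mutual_infoE; apply: eq_bigr => w _.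
have [->|qw] := eqVneq (q w) 0; first by rewrite !mul0r.
have X0 := law_gt0 hq.1 rv_X1 qw.
have -> : law q [% rv_X1, rv_V1] (rv_X1 w, rv_V1 w) =
    law q rv_X1 (rv_X1 w) * w1 (rv_X1 w) (rv_V1 w).
  rewrite (@joint_of_law_V1 _ _ _ _ p _ _ w1 w2 hw2 _ (fun s => s.1.1) id) //.
  by rewrite -(joint_of_law_source p hw1 hw2).
by congr (_ * log2 _); rewrite -mulf_div divff ?mul1r // gt_eqF.
Qed.

Let mean2 : \sum_w q w * log2 (w2 (rv_V1 w, rv_X2 w) (rv_V2 w) /
    r2 (rv_V1 w) (rv_V2 w)) = cond_mutual_info q rv_X2 rv_V2 rv_V1.
Proof.
rewrite (cond_mutual_infoE hq.1); apply: eq_bigr => w _.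
have [->|qw] := eqVneq (q w) 0; first by rewrite !mul0r.
have V0 := law_gt0 hq.1 rv_V1 qw.
have XV0 := law_gt0 hq.1 [% rv_X2, rv_V1] qw.
have -> : law q [% rv_X2, rv_V2, rv_V1] (rv_X2 w, rv_V2 w, rv_V1 w) =
    law q [% rv_X2, rv_V1] (rv_X2 w, rv_V1 w) *
    w2 (rv_V1 w, rv_X2 w) (rv_V2 w).
  transitivity (law q [% fun w => (w.1.2, w.1.1.1.2), rv_V2]
      (rv_V1 w, rv_X2 w, rv_V2 w)); first by law_perm.
  rewrite (@joint_of_law_V2 _ _ _ _ p _ _ w1 w2 _ (fun t => (t.2, t.1.1.2)) id) //.
  rewrite -(@joint_of_law_fst _ _ _ _ p _ _ w1 w2 hw2 _ (fun t => (t.2, t.1.1.2))).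
  by congr (_ * _); law_perm.
have -> : law q [% rv_V2, rv_V1] (rv_V2 w, rv_V1 w) =
    law q rv_V1 (rv_V1 w) * r2 (rv_V1 w) (rv_V2 w).
  by rewrite (kernel_ofE _ _ hq); law_perm.
congr (_ * log2 _).
rewrite [_ * w2 _ _ * _]mulrAC [law q [% rv_X2, rv_V1] _ * (_ * _)]mulrA.
rewrite -mulf_div divff ?mul1r // mulf_neq0 ?gt_eqF //.
Qed.

(** The ratio is inverted with respect to [mean1] and [mean2]: the covering densities must not be
    too large, whereas the density with respect to Y must not be too small. *)
Let mean3 : \sum_w q w * log2 (pY (rv_Y w) / r3 (rv_V1 w, rv_V2 w) (rv_Y w)) =
  - mutual_info q rv_Y [% rv_V1, rv_V2].
Proof.
rewrite mutual_infoE -sumrN; apply: eq_bigr => w _.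
have [->|qw] := eqVneq (q w) 0; first by rewrite !mul0r oppr0.
have V0 := law_gt0 hq.1 [% rv_V1, rv_V2] qw.
have Y0 := law_gt0 hq.1 rv_Y qw.
have -> : law q [% rv_Y, [% rv_V1, rv_V2]] (rv_Y w, [% rv_V1, rv_V2] w) =
    law q [% rv_V1, rv_V2] (rv_V1 w, rv_V2 w) *
    r3 (rv_V1 w, rv_V2 w) (rv_Y w).
  by rewrite (kernel_ofE _ _ hq); law_perm.
rewrite -mulrN -log2V; last first.
  by rewrite !(divr_gt0, mulr_gt0) // r3_gt0.
congr (_ * log2 _); rewrite invf_div [law q rv_Y _ * _]mulrC.
by rewrite -mulf_div divff ?mul1r ?pYE // gt_eqF.
Qed.

Variables (b1 b2 b3 : R).
Hypotheses (b1_gt0 : 0 < b1) (b2_gt0 : 0 < b2) (b3_gt0 : 0 < b3).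

Let dev1 n : R := \sum_(s : {ffun 'I_n -> _}) iid_pmf q s *
  (~~ (\prod_i w1 (rv_X1 (s i)) (rv_V1 (s i)) <=
       b1 ^+ n * \prod_i r1 (rv_V1 (s i))))%:R.
Let dev2 n : R := \sum_(s : {ffun 'I_n -> _}) iid_pmf q s *
  (~~ (\prod_i w2 (rv_V1 (s i), rv_X2 (s i)) (rv_V2 (s i)) <=
       b2 ^+ n * \prod_i r2 (rv_V1 (s i)) (rv_V2 (s i))))%:R.
Let dev3 n : R := \sum_(s : {ffun 'I_n -> _}) iid_pmf q s *
  (~~ (\prod_i pY (rv_Y (s i)) <=
       b3 ^+ n * \prod_i r3 (rv_V1 (s i), rv_V2 (s i)) (rv_Y (s i))))%:R.

Lemma block_code n M1 M2 eta : 0 < eta ->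
  exists c : CDIB_code A1 A2 n,
    [/\ #|msg1 c| = M1.+1, #|msg2 c| = M2.+1 &
    exists2 err : R,
      0 <= err <= dev1 n + b1 ^+ n / M1.+1%:R + eta^-1 *
       (dev2 n + b2 ^+ n / M2.+1%:R + eta^-1 * dev3 n) + 2 * eta &
      (1 - err) * log2 (b3 ^+ n)^-1 - 1 <=
      mutual_info (iid_pmf p (n := n)) (map_seq (@src_Y A1 A2 B) (n := n))
        [% @code_I1 A1 A2 B n c, @code_J1 A1 A2 B n c]].
Proof.
move=> eta0.
pose pn (x1 : {ffun 'I_n -> A1}) (x2 : {ffun 'I_n -> A2}) := \prod_i p12 (x1 i, x2 i).
pose Wn := iid_kernel W (n := n); pose w1n := iid_kernel w1 (n := n).
pose w2n (vx : {ffun 'I_n -> C1} * {ffun 'I_n -> A2}) (v2 : {ffun 'I_n -> C2}) :=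
  \prod_i w2 (vx.1 i, vx.2 i) (v2 i).
(* The Markov chain of the source is used here: the one-shot code wants Y generated from X2
   alone. *)
have joint_prod x1 x2 y (v1 : {ffun 'I_n -> C1}) (v2 : {ffun 'I_n -> C2}) :
    pn x1 x2 * Wn x2 y * w1n x1 v1 * w2n (v1, x2) v2 =
    \prod_i q (x1 i, x2 i, y i, v1 i, v2 i).
  rewrite -!big_split /=; apply: eq_bigr => i _.
  by rewrite /q /joint_of /= (source_factor hp hM).
have pn_sum : \sum_x1 \sum_x2 pn x1 x2 = 1.
  rewrite -big_ffun_pair /pn.
  under eq_bigr => s _ do under eq_bigr => i _ do
    rewrite !ffunE -surjective_pairing.
  by rewrite (sum_ffun_prod (fun=> p12)) big1 // => i _; rewrite sum_law hp.2.
have pn0 x1 x2 : 0 <= pn x1 x2 by apply: prodr_ge0 => i _; exact: (law_ge0 hp.1).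
have hw2n : is_kernel w2n.
  move=> vx; split=> [v2|]; first by apply: prodr_ge0 => i _; apply: (hw2 _).1.
  rewrite (sum_ffun_prod (fun i => w2 (vx.1 i, vx.2 i))) big1 // => i _.
  exact: (hw2 _).2.
have hr1n : is_pmf (iid_pmf r1 (n := n)).
  by apply: iid_pmfP; split=> [v|]; [exact: (law_ge0 hq.1)|rewrite sum_law hq.2].
have hr2n : is_kernel (iid_kernel r2 (n := n)) by apply/iid_kernelP/kernel_ofP.
pose G1 x1 v1 := w1n x1 v1 <= b1 ^+ n * iid_pmf r1 v1.
pose G2 vx v2 := w2n vx v2 <= b2 ^+ n * iid_kernel r2 vx.1 v2.
pose G3 (y : {ffun 'I_n -> B}) (v1 : {ffun 'I_n -> C1}) (v2 : {ffun 'I_n -> C2}) :=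
  \prod_i pY (y i) <= b3 ^+ n * \prod_i r3 (v1 i, v2 i) (y i).
have [c1 [f1 [c2 [f2 code]]]] := @one_shot_code R _ _ _ _ _ pn Wn w1n w2n
  (iid_pmf r1 (n := n)) (iid_kernel r2 (n := n)) pn0 pn_sum
  (iid_kernelP hW) (iid_kernelP hw1) hw2n hr1n hr2n G1 G2 G3 (b1 ^+ n) (b2 ^+ n)
  eta M1 M2 (exprn_gt0 _ b1_gt0) (exprn_gt0 _ b2_gt0) eta0
  (fun _ _ h => h) (fun _ _ _ h => h).
exists (@CDIBCode A1 A2 n 'I_M1.+1 'I_M2.+1 f1 (fun xi => f2 xi.2 xi.1)).
rewrite !card_ord; split=> //.
exists (\sum_x1 \sum_x2 \sum_y pn x1 x2 * Wn x2 y *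
    (~~ G3 y (c1 (f1 x1)) (c2 (f1 x1) (f2 (f1 x1) x2)))%:R).
  apply/andP; split.
    do 3 apply: sumr_ge0 => ? _.
    by rewrite !mulr_ge0 // (iid_kernelP hW _).1.
  have nest E : \sum_x1 \sum_x2 \sum_y \sum_v1 \sum_v2 pn x1 x2 * Wn x2 y *
      w1n x1 v1 * w2n (v1, x2) v2 * E x1 x2 y v1 v2 =
      \sum_(s : {ffun 'I_n -> _}) iid_pmf q s * E (map_seq rv_X1 s)
        (map_seq rv_X2 s) (map_seq rv_Y s) (map_seq rv_V1 s) (map_seq rv_V2 s).
    rewrite -(big_ffun5 (fun x1 x2 y v1 v2 => pn x1 x2 * Wn x2 y *
      w1n x1 v1 * w2n (v1, x2) v2 * E x1 x2 y v1 v2)).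
    apply: eq_bigr => s _; rewrite joint_prod; congr (_ * _).
    by apply: eq_bigr => i _; rewrite !ffunE; case: (s i) => [[[[? ?] ?] ?] ?].
  apply: le_trans code _.
  have -> : dev1 n = \sum_x1 \sum_x2 \sum_y \sum_v1 \sum_v2 pn x1 x2 * Wn x2 y *
      w1n x1 v1 * w2n (v1, x2) v2 * (~~ G1 x1 v1)%:R.
    rewrite (nest (fun x1 _ _ v1 _ => (~~ G1 x1 v1)%:R)); apply: eq_bigr => s _.
    congr (_ * (~~ (_ <= _ * _))%:R); apply: eq_bigr => i _; rewrite !ffunE //.
  have -> : dev2 n = \sum_x1 \sum_x2 \sum_y \sum_v1 \sum_v2 pn x1 x2 * Wn x2 y *
      w1n x1 v1 * w2n (v1, x2) v2 * (~~ G2 (v1, x2) v2)%:R.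
    rewrite (nest (fun _ x2 _ v1 v2 => (~~ G2 (v1, x2) v2)%:R)); apply: eq_bigr => s _.
    congr (_ * (~~ (_ <= _ * _))%:R); apply: eq_bigr => i _; rewrite !ffunE //.
  have -> : dev3 n = \sum_x1 \sum_x2 \sum_y \sum_v1 \sum_v2 pn x1 x2 * Wn x2 y *
      w1n x1 v1 * w2n (v1, x2) v2 * (~~ G3 y v1 v2)%:R.
    rewrite (nest (fun _ _ y v1 v2 => (~~ G3 y v1 v2)%:R)); apply: eq_bigr => s _.
    congr (_ * (~~ (_ <= _ * _))%:R); apply: eq_bigr => i _; rewrite !ffunE //.
  exact: lexx.
(* Reference channel for [mutual_info_ge]: the conditional law of Y at the two codewords that the
   messages name. *)
pose r (k : 'I_M1.+1 * 'I_M2.+1) (y : {ffun 'I_n -> B}) :=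
  \prod_i r3 (c1 k.1 i, c2 k.1 k.2 i) (y i).
have hr : is_kernel r.
  move=> k; split=> [y|]; first by apply: prodr_ge0 => i _; apply: (hr3 _).1.
  rewrite /r (sum_ffun_prod (fun i => r3 (c1 k.1 i, c2 k.1 k.2 i))) big1 // => i _.
  exact: (hr3 _).2.
have b3n : 0 < (b3 ^+ n)^-1 by rewrite invr_gt0 exprn_gt0.
set c := CDIBCode _ _.
have := mutual_info_ge (map_seq (@src_Y A1 A2 B) (n := n))
  [% @code_I1 A1 A2 B n c, @code_J1 A1 A2 B n c] (iid_pmfP n hp) hr b3n.
apply: le_trans; rewrite le_eqVlt; apply/orP; left; apply/eqP; congr ((1 - _) * _ - _).
rewrite -(big_ffun3 (fun x1 x2 y => pn x1 x2 * Wn x2 y *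
  (~~ G3 y (c1 (f1 x1)) (c2 (f1 x1) (f2 (f1 x1) x2)))%:R)).
apply: eq_bigr => s _; congr (_ * (~~ _)%:R).
  rewrite -big_split /=; apply: eq_bigr => i _.
  by rewrite (source_factor hp hM) !ffunE; case: (s i) => [[? ?] ?].
by rewrite law_map_seq ler_pdivrMl ?exprn_gt0.
Qed.

Lemma deviations_vanish :
  mutual_info q rv_X1 rv_V1 < log2 b1 ->
  cond_mutual_info q rv_X2 rv_V2 rv_V1 < log2 b2 ->
  - mutual_info q rv_Y [% rv_V1, rv_V2] < log2 b3 ->
  forall c, 0 < c -> exists N, forall n, (N < n)%N ->
    [/\ dev1 n <= c, dev2 n <= c & dev3 n <= c].
Proof.
rewrite -mean1 -mean2 -mean3 => m1 m2 m3 c c0.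
have [rho1 /geometric_le /(_ c0) [N1 hN1] d1] :=
  likelihood_ratio_deviation hq w1_gt0 r1_gt0 b1_gt0 m1.
have [rho2 /geometric_le /(_ c0) [N2 hN2] d2] :=
  likelihood_ratio_deviation hq w2_gt0 r2_gt0 b2_gt0 m2.
have [rho3 /geometric_le /(_ c0) [N3 hN3] d3] :=
  likelihood_ratio_deviation hq pY_gt0 r3_gt0 b3_gt0 m3.
exists (N1 + N2 + N3)%N => n Nn; split.
- by apply: le_trans (d1 n) (hN1 _ _); lia.
- by apply: le_trans (d2 n) (hN2 _ _); lia.
- by apply: le_trans (d3 n) (hN3 _ _); lia.
Qed.

End Kernels.
End Achievability.

Section KernelAchievable.
Context {R : realType}.

(** Half of the slack eps pays for the density threshold and the other half makes the covering term
    vanish; the factor 2 on the right is the rounding in [codebook_size]. *)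
Lemma rate_slack (I Rt eps : R) n M : I <= Rt ->
  2 `^ (n%:R * (Rt + eps)) <= 2 * M.+1%:R :> R ->
  (2 `^ (I + eps / 2)) ^+ n / M.+1%:R <= 2 * (2 `^ (- (eps / 2))) ^+ n.
Proof.
move=> IR hM; rewrite ler_pdivrMr ?ltr0n // [leRHS]mulrAC [leRHS]mulrC.
apply: (@le_trans _ _ (2 `^ (- (eps / 2) * n%:R) * 2 `^ (n%:R * (Rt + eps)))).
  rewrite !powR2X -powRD; last by rewrite pnatr_eq0 implybT.
  rewrite ler_powR ?ler1n //.
  have : I * n%:R <= Rt * n%:R by rewrite ler_wpM2r.
  lra.
by rewrite powR2X ler_wpM2l // powR_ge0.
Qed.

Lemma kernel_achievable (A1 A2 B : finType) (p : A1 * A2 * B -> R) R1 R2 mu :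
  is_pmf p ->
  markov_chain p (@src_X1 A1 A2 B) (@src_X2 A1 A2 B) (@src_Y A1 A2 B) ->
  0 <= R1 -> 0 <= R2 -> 0 <= mu ->
  single_letter_kernel p (R1, R2, mu) -> R_CDIB p (R1, R2, mu).
Proof.
move=> hp hM R10 R20 mu0 [C1 [C2 [w1 [w2 [hw1 hw2]]]]].
rewrite /rate_constraints; set I1 := mutual_info _ rv_X1 _; set I2 := cond_mutual_info _ _ _ _.
set I3 := mutual_info _ rv_Y _ => -[IR1 IR2 muI].
split=> // eps eps0.
(* The loss in information consists of eps / 4 in the exponent of [b3], at most eps / 4 for an error
   of at most [e0], and at most eps / 4 for the lost bit once n >= 4 / eps. *)
pose e0 := eps / (4 * (I3 + 1)); pose eta := e0 / 4.
have I30 : 0 <= I3 by apply: le_trans muI.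
have I3p : 0 < I3 + 1 by rewrite ltr_wpDl.
have e00 : 0 < e0 by rewrite divr_gt0 // mulr_gt0.
have eta0 : 0 < eta by rewrite divr_gt0.
(* The first two deviations, each at most [c], come with a covering term of at most 2 c; the third
   has weight eta^-2. Together they give c D = e0 / 2, and 2 eta is the other half of [e0]. *)
pose D := 3 + 3 * eta^-1 + eta^-1 * eta^-1.
have etaV : 0 < eta^-1 by rewrite invr_gt0.
have D0 : 0 < D by rewrite /D !addr_gt0 ?mulr_gt0.
pose c := e0 / 2 / D.
have c0 : 0 < c by apply: divr_gt0 => //; apply: divr_gt0.
pose b1 : R := 2 `^ (I1 + eps / 2); pose b2 : R := 2 `^ (I2 + eps / 2).
pose b3 : R := 2 `^ (- (I3 - eps / 4)).
have b1_gt0 : 0 < b1 by rewrite powR_gt0.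
have b2_gt0 : 0 < b2 by rewrite powR_gt0.
have b3_gt0 : 0 < b3 by rewrite powR_gt0.
have h1 : I1 < log2 b1 by rewrite log2_powR; lra.
have h2 : I2 < log2 b2 by rewrite log2_powR; lra.
have h3 : - I3 < log2 b3 by rewrite log2_powR; lra.
have [N1 small] :=
  deviations_vanish hp hw1 hw2 b1_gt0 b2_gt0 b3_gt0 h1 h2 h3 c0.
have rho0 : 0 <= (2 : R) `^ (- (eps / 2)) < 1.
  rewrite powR_ge0 /= /powR pnatr_eq0 /= expR_lt1 nmulr_rlt0 ?ln2_gt0 //.
  by rewrite oppr_lt0 divr_gt0.
have [N2 geo] := geometric_le rho0 c0.
have [N3 hN3] : exists N : nat, 4 / eps < N.+1%:R.
  by exists (Num.truncn (4 / eps)); apply: truncnS_gt.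
exists (N1 + N2 + N3)%N => n Nn.
have nN1 : (N1 < n)%N by clear -Nn; lia.
have nN2 : (N2 < n)%N by clear -Nn; lia.
have nN3 : (N3 < n)%N by clear -Nn; lia.
have [d1 d2 d3] := small n nN1.
have gn := geo n nN2.
have n_eps : 4 / eps <= n%:R.
  by apply: (le_trans (ltW hN3)); rewrite ler_nat.
have n0 : 0 < n%:R :> R by apply: lt_le_trans n_eps; rewrite divr_gt0.
have [|M1 [M1le M1ge]] := @codebook_size R (n%:R * (R1 + eps)).
  by rewrite mulr_ge0 // addr_ge0 // ltW.
have [|M2 [M2le M2ge]] := @codebook_size R (n%:R * (R2 + eps)).
  by rewrite mulr_ge0 // addr_ge0 // ltW.
have s1 := rate_slack IR1 M1ge; have s2 := rate_slack IR2 M2ge.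
have [code [m1 m2 [err /andP[err0 err_le] info]]] :=
  block_code hp hM hw1 hw2 b1_gt0 b2_gt0 b3_gt0 n M1 M2 eta0.
exists code; split.
- by rewrite m1 ler_pdivrMl.
- by rewrite m2 ler_pdivrMl.
rewrite ler_pdivlMl //; apply: le_trans info.
have -> : log2 (b3 ^+ n)^-1 = (I3 - eps / 4) * n%:R.
  by rewrite /b3 powR2X -powRN log2_powR; ring.
have err_e0 : err <= e0.
  apply: le_trans err_le _.
  have dD : c * D = e0 / 2 by rewrite /c divfK // gt_eqF.
  have -> : e0 = c * 3 + eta^-1 * (c * 3 + eta^-1 * c) + 2 * eta.
    have -> : c * 3 + eta^-1 * (c * 3 + eta^-1 * c) = c * D by rewrite /D; ring.
    by rewrite dD /eta; lra.
  rewrite lerD2r; apply: lerD.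
    by apply: le_trans (lerD d1 s1) _; lra.
  rewrite ler_pM2l //; apply: lerD; last by rewrite ler_pM2l.
  by apply: le_trans (lerD d2 s2) _; lra.
have err_I : err * (I3 - eps / 4) <= eps / 4.
  apply: (@le_trans _ _ (e0 * (I3 + 1))); last first.
    by rewrite /e0 le_eqVlt; apply/orP; left; apply/eqP; field; rewrite gt_eqF.
  apply: (@le_trans _ _ (err * (I3 + 1))); last by rewrite ler_pM2r.
  by rewrite ler_wpM2l //; lra.
have n_eps' : 1 <= n%:R * (eps / 4).
  by move: n_eps; rewrite ler_pdivrMr // => h; lra.
have : n%:R * (err * (I3 - eps / 4)) <= n%:R * (eps / 4) by rewrite ler_pM2l.
have : n%:R * mu <= n%:R * I3 by rewrite ler_pM2l.
lra.
Qed.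

End KernelAchievable.

(** * Converse *)

Section TimeSharing.
Context {R : realType} {A1 A2 B : finType}.
Local Notation S := (A1 * A2 * B)%type.
Variable p : S -> R.

Lemma hat_slices_weaken (C1 C2 : finType) (q : S * C1 * C2 -> R) r R1 R2 mu :
  hat_slices p q r -> r.1.1 <= R1 -> r.1.2 <= R2 -> mu <= r.2 ->
  hat_slices p q (R1, R2, mu).
Proof.
case=> q0 qs [i1 i2 i3] c1 c2 h1 h2 h3; split=> //.
by split; [apply: le_trans h1|apply: le_trans h2|apply: le_trans h3 _].
Qed.

(** A uniform time index becomes part of V1. All the [q i] have the same source marginal, so the
    index tells nothing about the source and the quantities average exactly. *)
Lemma time_sharing n (C1 C2 : finType) (q : 'I_n -> S * C1 * C2 -> R)
    (r1 r2 r3 : 'I_n -> R) : (0 < n)%N ->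
  (forall i, hat_slices p (q i) (r1 i, r2 i, r3 i)) ->
  exists q' : S * ('I_n * C1) * C2 -> R,
    hat_slices p q' (n%:R^-1 * \sum_i r1 i, n%:R^-1 * \sum_i r2 i,
                     n%:R^-1 * \sum_i r3 i).
Proof.
move=> n0 hq.
have nV0 : 0 <= n%:R^-1 :> R by rewrite invr_ge0.
have nn : n%:R != 0 :> R by rewrite pnatr_eq0 -lt0n.
pose q' (w : S * ('I_n * C1) * C2) := n%:R^-1 * q w.1.2.1 (w.1.1, w.1.2.2, w.2).
have q'12 (A : finType) (F : S -> A) a i v1 v2 :
    slice12 q' F a (i, v1) v2 = n%:R^-1 * slice12 (q i) F a v1 v2.
  by rewrite /slice12 mulr_sumr; apply: eq_bigr => s _; rewrite /q' mulrA.
have q'1 (A : finType) (F : S -> A) a i v1 :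
    slice1 q' F a (i, v1) = n%:R^-1 * slice1 (q i) F a v1.
  by rewrite /slice1 mulr_sumr; apply: eq_bigr.
have q0 (A : finType) (F : S -> A) a i : slice0 (q i) F a = law p F a.
  have [q_0 qs _ _ _] := hq i; rewrite -law_slice0.
  rewrite -[LHS](law_comp (q i) (fun w => w.1.1) F).
  by apply: law_ext => // s; rewrite -qs -law_slice0.
have q'0 (A : finType) (F : S -> A) a : slice0 q' F a = law p F a.
  rewrite /slice0 sum_prod.
  transitivity (\sum_(i < n) n%:R^-1 * law p F a).
    apply: eq_bigr => i _; rewrite -(q0 _ _ _ i) mulr_sumr.
    by apply: eq_bigr => v1 _; rewrite q'1.
  by rewrite -mulr_sumr sumr_const card_ord -[law p F a *+ n]mulr_natl mulrA mulVf // mul1r.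
exists q'; split.
- by move=> w; rewrite mulr_ge0 //; case: (hq w.1.2.1).
- by move=> s; rewrite q'0 law_id.
- split.
  + have -> : mutual_info q' rv_X1 rv_V1 =
        n%:R^-1 * \sum_i mutual_info (q i) rv_X1 rv_V1.
      rewrite mutual_info1_slice sum_prod mulr_sumr; apply: eq_bigr => i _.
      rewrite mutual_info1_slice mulr_sumr; apply: eq_bigr => v1 _.
      rewrite mulr_sumr; apply: eq_bigr => x1 _.
      by rewrite !q'1 q'0 info_term_scale q0.
    by rewrite ler_wpM2l // ler_sum // => i _; case: (hq i) => _ _ [].
  + have -> : cond_mutual_info q' rv_X2 rv_V2 rv_V1 =
        n%:R^-1 * \sum_i cond_mutual_info (q i) rv_X2 rv_V2 rv_V1.
      rewrite cond_mutual_info_slice sum_prod mulr_sumr; apply: eq_bigr => i _.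
      rewrite cond_mutual_info_slice mulr_sumr; apply: eq_bigr => v1 _.
      rewrite mulr_sumr; apply: eq_bigr => v2 _.
      rewrite mulr_sumr; apply: eq_bigr => x2 _.
      by rewrite !q'1 !q'12 cond_info_term_scale4.
    by rewrite ler_wpM2l // ler_sum // => i _; case: (hq i) => _ _ [].
  + have -> : mutual_info q' rv_Y [% rv_V1, rv_V2] =
        n%:R^-1 * \sum_i mutual_info (q i) rv_Y [% rv_V1, rv_V2].
      rewrite mutual_info2_slice sum_prod mulr_sumr; apply: eq_bigr => i _.
      rewrite mutual_info2_slice mulr_sumr; apply: eq_bigr => v1 _.
      rewrite mulr_sumr; apply: eq_bigr => v2 _.
      rewrite mulr_sumr; apply: eq_bigr => y _.
      by rewrite !q'12 q'0 info_term_scale q0.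
    by rewrite ler_wpM2l // ler_sum // => i _; case: (hq i) => _ _ [].
- move=> s [i v1]; rewrite !q'1 !q'0 -!(q0 _ _ _ i) -!mulrA.
  by have [_ _ _ -> _] := hq i.
- move=> s [i v1] v2; rewrite !q'1 !q'12 mulrACA [RHS]mulrACA.
  by have [_ _ _ _ ->] := hq i.
Qed.

(** Both cross-multiplied chains become identities, because [K] does not see Y and its V1-marginal
    sees only X1. *)
Lemma hat_slices_channel (C1 C2 : finType) (q : S * C1 * C2 -> R)
    (K : A1 * A2 -> C1 -> C2 -> R) (K1 : A1 -> C1 -> R) :
  is_pmf p -> (forall w, q w = p w.1.1 * K w.1.1.1 w.1.2 w.2) ->
  (forall a v1 v2, 0 <= K a v1 v2) ->
  (forall a v1, \sum_v2 K a v1 v2 = K1 a.1 v1) ->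
  (forall a, \sum_v1 K1 a v1 = 1) ->
  hat_slices p q (mutual_info q rv_X1 rv_V1, cond_mutual_info q rv_X2 rv_V2 rv_V1,
                  mutual_info q rv_Y [% rv_V1, rv_V2]).
Proof.
move=> hp qE K0 KK1 K11.
have q12 (A : finType) (F : S -> A) (g : A -> A1 * A2) a v1 v2 :
    (forall s, s.1 = g (F s)) ->
    slice12 q F a v1 v2 = law p F a * K (g a) v1 v2.
  move=> gF; rewrite /slice12 lawE mulr_suml; apply: eq_bigr => s _.
  rewrite qE /= gF; have [->|] := eqVneq (F s) a; first by rewrite !mulr1.
  by rewrite !mulr0 mul0r.
have q1 (A : finType) (F : S -> A) (g : A -> A1) a v1 :
    (forall s, s.1.1 = g (F s)) -> slice1 q F a v1 = law p F a * K1 (g a) v1.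
  move=> gF; rewrite /slice1 /slice12 exchange_big lawE mulr_suml.
  apply: eq_bigr => s _ /=; under eq_bigr do rewrite qE /=.
  rewrite -mulr_suml -mulr_sumr KK1 gF.
  have [->|] := eqVneq (F s) a; first by rewrite !mulr1.
  by rewrite !mulr0 mul0r.
have q0 (A : finType) (F : S -> A) a : slice0 q F a = law p F a.
  rewrite -law_slice0 -[LHS](law_comp q (fun w => w.1.1) F).
  apply: law_ext => // s; rewrite [LHS](law_slice0 q id) /slice0.
  under eq_bigr do rewrite (q1 _ id (fun s => s.1.1)) //.
  by rewrite -mulr_sumr K11 mulr1 law_id.
split=> //.
- by move=> w; rewrite qE mulr_ge0 // hp.1.
- by move=> s; rewrite q0 law_id.
- move=> s v1; rewrite !q0 (q1 _ id (fun s => s.1.1)) //.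
  by rewrite (q1 _ _ id) //; ring.
- move=> s v1 v2; rewrite (q1 _ id (fun s => s.1.1)) // (q1 _ _ fst) //.
  by rewrite (q12 _ id fst) // (q12 _ _ id) //; ring.
Qed.

End TimeSharing.

(** * Prefixes, resampling of a coordinate and entropy of product laws *)

Section IidEntropy.
Context {R : realType}.

Definition set_coord (T : finType) n (i : 'I_n) (t : T) (s : {ffun 'I_n -> T}) :
  {ffun 'I_n -> T} := [ffun j => if j == i then t else s j].

(** A masked word of full length has a type independent of [k], so all times share the V1 alphabet
    that time sharing requires. *)
Definition prefix (T : finType) n k (s : {ffun 'I_n -> T}) :
  {ffun 'I_n -> option T} := [ffun j : 'I_n => if (j < k)%N then Some (s j) else None].

Lemma prefix_eq (T : finType) n k (s s' : {ffun 'I_n -> T}) :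
  prefix k s = prefix k s' <-> forall j : 'I_n, (j < k)%N -> s j = s' j.
Proof.
split=> [/ffunP ss' j jk|ss'].
  by have := ss' j; rewrite !ffunE jk => -[].
by apply/ffunP => j; rewrite !ffunE; case: ifP => // /ss' ->.
Qed.

Lemma prefixS_eq (T : finType) n (i : 'I_n) (s s' : {ffun 'I_n -> T}) :
  prefix i.+1 s = prefix i.+1 s' <-> s i = s' i /\ prefix i s = prefix i s'.
Proof.
rewrite !prefix_eq; split=> [h|[hi h] j].
  by split=> [|j ji]; apply: h => //; rewrite ltnS ltnW.
rewrite ltnS leq_eqVlt => /orP[/eqP/val_inj ->//|]; exact: h.
Qed.

Lemma prefix_full (T : finType) n (s s' : {ffun 'I_n -> T}) :
  prefix n s = prefix n s' <-> s = s'.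
Proof. by rewrite prefix_eq; split=> [h|-> //]; apply/ffunP => j; apply: h. Qed.

Variables (T : finType) (p : T -> R).
Hypothesis hp : is_pmf p.

(** By independence of the coordinates, restricting to the value [t] at [i] amounts to overwriting
    that coordinate, up to the factor [p t]. *)
Lemma iid_resample n (i : 'I_n) (g : {ffun 'I_n -> T} -> R) t :
  \sum_(s : {ffun 'I_n -> T}) iid_pmf p s * (g s * (s i == t)%:R) =
  p t * \sum_(s : {ffun 'I_n -> T}) iid_pmf p s * g (set_coord i t s).
Proof.
have split_i (s : {ffun 'I_n -> T}) :
    iid_pmf p s = p (s i) * \prod_(j | j != i) p (s j).
  by rewrite /iid_pmf (bigD1 i).
pose rest (s : {ffun 'I_n -> T}) := \prod_(j | j != i) p (s j).
have rest_set u s : rest (set_coord i u s) = rest s.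
  by apply: eq_bigr => j /negbTE ji; rewrite ffunE ji.
transitivity (p t * \sum_(s : {ffun 'I_n -> T} | s i == t) rest s * g s).
  rewrite mulr_sumr big_mkcond [RHS]big_mkcond; apply: eq_bigr => s _ /=.
  by rewrite split_i; case: eqP => [<-|]; rewrite ?mulr1 ?mulr0 // mulrA.
congr (_ * _).
have move_i u : \sum_(s : {ffun 'I_n -> T} | s i == t) rest s * g s =
    \sum_(s : {ffun 'I_n -> T} | s i == u) rest s * g (set_coord i t s).
  rewrite (reindex_onto (set_coord i t) (set_coord i u)) /=; last first.
    move=> s /eqP si; apply/ffunP => j; rewrite !ffunE.
    by case: eqP => // ->.
  apply: eq_big => [s|s _]; last by rewrite rest_set.
  rewrite ffunE eqxx eqxx /=; apply/eqP/eqP => [<-|si].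
    by rewrite ffunE eqxx.
  by apply/ffunP => j; rewrite !ffunE; case: eqP => // ->; rewrite si.
(* A dummy value [u] of total mass 1 is introduced; it then serves as coordinate [i] of the word
   being overwritten. *)
transitivity (\sum_u p u * \sum_(s : {ffun 'I_n -> T} | s i == t) rest s * g s).
  by rewrite -mulr_suml hp.2 mul1r.
rewrite [RHS](partition_big (fun s : {ffun 'I_n -> T} => s i) predT) //=.
apply: eq_bigr => u _; rewrite (move_i u) mulr_sumr; apply: eq_bigr => s /eqP si.
by rewrite split_i si mulrA.
Qed.

Lemma law_iid_pair n (i : 'I_n) (A : finType) (F : {ffun 'I_n -> T} -> A) t a :
  law (iid_pmf p (n := n)) [% fun s : {ffun 'I_n -> T} => s i, F] (t, a) =
  p t * \sum_(s : {ffun 'I_n -> T}) iid_pmf p s * (F (set_coord i t s) == a)%:R.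
Proof.
rewrite -(iid_resample i (fun s => (F s == a)%:R)) lawE; apply: eq_bigr => s _.
by rewrite xpair_eqE -natrM mulnb andbC.
Qed.

Lemma law_iid_coord n (i : 'I_n) t : 
    law (iid_pmf p (n := n)) (fun s : {ffun 'I_n -> T} => s i) t = p t.
Proof.
have := iid_resample i (fun=> 1) t; rewrite lawE.
under eq_bigr do rewrite mul1r; move=> ->.
under eq_bigr do rewrite mulr1.
by rewrite (iid_pmfP n hp).2 mulr1.
Qed.

Lemma log2_prod (I : finType) (f : I -> R) :
  (forall i, 0 < f i) -> log2 (\prod_i f i) = \sum_i log2 (f i).
Proof.
move=> f0; suff [] : 0 < \prod_i f i /\ log2 (\prod_i f i) = \sum_i log2 (f i) by [].
elim/big_rec2: _ => [|i y1 y2 _ [y0 IH]]; first by rewrite ltr01 /log2 ln1 mul0r.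
by rewrite mulr_gt0 // log2M // IH.
Qed.

Lemma entropy_law (W A : finType) (q : W -> R) (X : W -> A) :
  entropy q X = entropy (law q X) id.
Proof. by congr (- _); apply: eq_bigr => a _; rewrite law_id. Qed.

Lemma entropy_iid_coord n (i : 'I_n) (A : finType) (X : T -> A) :
  entropy (iid_pmf p (n := n)) (fun s : {ffun 'I_n -> T} => X (s i)) = entropy p X.
Proof.
rewrite /entropy; congr (- _); apply: eq_bigr => a _.
suff -> : law (iid_pmf p (n := n)) (fun s : {ffun 'I_n -> T} => X (s i)) a = law p X a by [].
rewrite -[LHS](law_comp _ (fun s : {ffun 'I_n -> T} => s i) X).
by apply: law_ext => // t; apply: law_iid_coord.
Qed.

Lemma entropy_iid n : entropy (iid_pmf p (n := n)) id = n%:R * entropy p id.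
Proof.
rewrite entropyE; under eq_bigr do rewrite law_id.
transitivity (- \sum_(s : {ffun 'I_n -> T}) \sum_i iid_pmf p s * log2 (p (s i))).
  congr (- _); apply: eq_bigr => s _; rewrite -mulr_sumr.
  have [->|ps] := eqVneq (iid_pmf p s) 0; first by rewrite !mul0r.
  have psi i : 0 < p (s i).
    rewrite lt_def hp.1 andbT; apply: contraNneq ps => psi.
    by rewrite /iid_pmf (bigD1 i) //= psi mul0r.
  congr (_ * _); rewrite /iid_pmf.
  by apply: log2_prod.
rewrite exchange_big -sumrN.
transitivity (\sum_(i < n) entropy p id).
  apply: eq_bigr => i _; rewrite entropyE; congr (- _).
  rewrite -[LHS](expect_law _ (fun s : {ffun 'I_n -> T} => s i) (fun t => log2 (p t))).
  by apply: eq_bigr => t _; rewrite law_iid_coord law_id.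
by rewrite sumr_const card_ord mulr_natl.
Qed.

End IidEntropy.

(** * Single-letterisation of a given code *)

Section Converse.
Context {R : realType} {A1 A2 B : finType}.
Local Notation S := (A1 * A2 * B)%type.
Variable p : S -> R.
Hypothesis hp : is_pmf p.
Variable n : nat.

Let P := iid_pmf p (n := n).
Let hP : is_pmf P. Proof. exact: iid_pmfP. Qed.

Section Telescoping.
Variables (M1 M2 : finType) (I : {ffun 'I_n -> S} -> M1) (J : {ffun 'I_n -> S} -> M2).
Let Yn := map_seq (@src_Y A1 A2 B) (n := n).
Let coord (i : 'I_n) (s : {ffun 'I_n -> S}) := s i.
(* The past of the whole source triple, rather than of [X1] and [X2] only, keeps
   the auxiliary variable admissible and makes all the sums below telescope. *)
Let U k : {ffun 'I_n -> S} -> M1 * {ffun 'I_n -> option S} :=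
  [% I, prefix k].
Let hI k := entropy P (U k).
Let hJI k := entropy P [% J, U k].
Let hY k := entropy P [% [% I, J], fun s => prefix k (Yn s)].

Let telescope (f : nat -> R) : \sum_(i < n) (f i.+1 - f i) = f n - f 0.
Proof. by rewrite -(big_mkord xpredT (fun i => f i.+1 - f i)) telescope_sumr. Qed.

Let U_full s s' : U n s = U n s' <-> s = s'.
Proof. by rewrite /U /rv_pair; split=> [[_ /prefix_full]|->]. Qed.

Let hI_full : hI n = n%:R * entropy p id.
Proof.
rewrite -(entropy_iid hp) /hI; apply: entropy_congr => s s'; exact: U_full.
Qed.

Let hJI_full : hJI n = n%:R * entropy p id.
Proof.
rewrite -(entropy_iid hp) /hJI; apply: entropy_congr => s s'.
by rewrite /U /rv_pair; split=> [[_ _ /prefix_full]|->].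
Qed.

Let prefix0 (T : finType) (s s' : {ffun 'I_n -> T}) : prefix 0 s = prefix 0 s'.
Proof. by apply/prefix_eq. Qed.

Let hI_zero : hI 0 = entropy P I.
Proof.
apply: entropy_congr => s s'; rewrite /U /rv_pair (prefix0 s s').
by split=> [[->]|->].
Qed.

Let hJI_zero : hJI 0 = entropy P [% J, I].
Proof.
apply: entropy_congr => s s'; rewrite /U /rv_pair (prefix0 s s').
by split=> -[-> ->].
Qed.

Let hIS (i : 'I_n) : entropy P [% coord i, U i] = hI i.+1.
Proof.
apply: entropy_congr => s s'; rewrite /U /rv_pair /coord; split.
  by move=> [si -> pre]; congr (_, _); apply/prefixS_eq.
by move=> [-> /prefixS_eq [-> ->]].
Qed.

Let hJIS (i : 'I_n) : entropy P [% J, [% coord i, U i]] = hJI i.+1.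
Proof.
apply: entropy_congr => s s'; rewrite /U /rv_pair /coord; split.
  by move=> [-> si -> pre]; congr (_, (_, _)); apply/prefixS_eq.
by move=> [-> -> /prefixS_eq [-> ->]].
Qed.

(** After enlarging X1 to the whole triple, each term is H(S) - (hI i.+1 - hI i). As [hI n] is n
    H(S), the sum telescopes to H(I). *)
Lemma converse_rate1 :
  \sum_(i < n) mutual_info P (fun s => (s i).1.1) (U i) <= log2 #|M1|%:R.
Proof.
apply: le_trans (entropy_le_card hP.1 hP.2 I).
apply: (@le_trans _ _ (\sum_(i < n) (entropy p id - (hI i.+1 - hI i)))); last first.
  rewrite sumrB telescope sumr_const card_ord hI_full hI_zero -[_ *+ n]mulr_natl.
  lra.
apply: ler_sum => i _.
have sub s s' : coord i s = coord i s' -> (s i).1.1 = (s' i).1.1.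
  by rewrite /coord => ->.
apply: le_trans (mutual_info_sub hP.1 _ sub) _.
rewrite (mutual_info_entropy hP.1) hIS.
rewrite -[entropy p id](entropy_iid_coord hp i id) /hI /coord; lra.
Qed.

(** With X2 enlarged to the triple, the sum telescopes to H(J, I) - H(I), since [hI n] and [hJI n]
    both equal the entropy of the full word; this is H(J | I) <= H(J). *)
Lemma converse_rate2 :
  \sum_(i < n) cond_mutual_info P (fun s => (s i).1.2) J (U i) <=
  log2 #|M2|%:R.
Proof.
apply: le_trans (entropy_le_card hP.1 hP.2 J).
apply: (@le_trans _ _ (entropy P [% J, I] - entropy P I)); last first.
  have := @cond_entropy_le _ _ P hP.1 _ _ _ J I (fun=> tt) (fun _ _ _ => erefl).
  rewrite (entropy_const hP.2 (a := tt)) // subr0.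
  rewrite (@entropy_congr _ _ P _ _ [% J, fun=> tt] J) //.
  by move=> s s'; rewrite /rv_pair; split=> [[->]|->].
apply: (@le_trans _ _ (\sum_(i < n) ((hI i.+1 - hI i) - (hJI i.+1 - hJI i)))); last first.
  rewrite sumrB !telescope hI_full hJI_full hI_zero hJI_zero; lra.
apply: ler_sum => i _.
have sub s s' : coord i s = coord i s' -> (s i).1.2 = (s' i).1.2.
  by rewrite /coord => ->.
apply: le_trans (cond_mutual_info_sub hP.1 _ _ sub) _.
rewrite (cond_mutual_info_entropy hP.1) hIS -hJIS.
rewrite (@entropy_congr _ _ P _ _ [% coord i, J, U i] [% J, [% coord i, U i]]).
  by rewrite /hI /hJI; lra.
by move=> s s'; rewrite /U /rv_pair; split=> -[-> -> -> ->].
Qed.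

(** The chain rule conditions Y_i on the messages and the past of Y only; replacing this past by
    that of the triple can only lower the conditional entropy. *)
Lemma converse_info : mutual_info P Yn [% I, J] <=
  \sum_(i < n) mutual_info P (fun s => (s i).2) [% U i, J].
Proof.
rewrite (mutual_info_entropy hP.1).
have -> : entropy P Yn = n%:R * entropy p (@src_Y A1 A2 B).
  have hpY : is_pmf (law p (@src_Y A1 A2 B)).
    by split=> [y|]; [exact: (law_ge0 hp.1)|rewrite sum_law hp.2].
  have law_Yn : law P Yn = iid_pmf (law p (@src_Y A1 A2 B)) (n := n).
    by apply/funext => y; rewrite law_map_seq.
  by rewrite [LHS]entropy_law law_Yn (entropy_iid hpY) -entropy_law.
have -> : entropy P [% Yn, [% I, J]] = hY n.
  apply: entropy_congr => s s'; rewrite /rv_pair; split=> -[].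
    by move=> -> -> ->.
  by move=> -> -> /prefix_full ->.
have -> : entropy P [% I, J] = hY 0.
  apply: entropy_congr => s s'; rewrite /rv_pair (prefix0 (Yn s) (Yn s')).
  by split=> -[-> ->].
apply: (@le_trans _ _ (\sum_(i < n) (entropy p (@src_Y A1 A2 B) - (hY i.+1 - hY i)))).
  by rewrite sumrB telescope sumr_const card_ord -[_ *+ n]mulr_natl; lra.
apply: ler_sum => i _; rewrite (mutual_info_entropy hP.1).
rewrite -(entropy_iid_coord hp i (@src_Y A1 A2 B)) -/P.
have -> : hY i.+1 = entropy P [% fun s : {ffun 'I_n -> S} => src_Y (s i),
    [% [% I, J], fun s : {ffun 'I_n -> S} => prefix i (Yn s)]].
  apply: entropy_congr => s s'; rewrite /rv_pair; split.
    by move=> [-> -> /prefixS_eq []]; rewrite !ffunE => -> ->.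
  move=> [si -> -> pre]; congr (_, _); apply/prefixS_eq.
  by rewrite !ffunE.
have sub s s' : [% U i, J] s = [% U i, J] s' ->
    [% [% I, J], fun s : {ffun 'I_n -> S} => prefix i (Yn s)] s =
    [% [% I, J], fun s : {ffun 'I_n -> S} => prefix i (Yn s)] s'.
  rewrite /U /rv_pair => -[-> /prefix_eq pre ->]; congr (_, _).
  by apply/prefix_eq => j ji; rewrite !ffunE pre.
have h := cond_entropy_le hP.1 (fun s : {ffun 'I_n -> S} => src_Y (s i)) sub.
rewrite /hY; move: h; rewrite /src_Y; lra.
Qed.

End Telescoping.

Variable c : CDIB_code A1 A2 n.
Let I := @code_I1 A1 A2 B n c.
Let J := @code_J1 A1 A2 B n c.
Let U k : {ffun 'I_n -> S} -> msg1 c * {ffun 'I_n -> option S} := [% I, prefix k].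

(** Conditional law of the auxiliary pair given (X1_i, X2_i) = a: draw a fresh word, overwrite its
    coordinate [i] and run the encoders. The prefix stops before [i], so it is not affected. *)
Let K (i : 'I_n) (a : A1 * A2) (v1 : msg1 c * {ffun 'I_n -> option S})
    (v2 : msg2 c) : R :=
  \sum_s P s * ((let m := enc1 c (set_coord i a.1 (map_seq (@src_X1 A1 A2 B) s)) in
    (m, prefix i s, enc2 (set_coord i a.2 (map_seq (@src_X2 A1 A2 B) s), m)))
    == (v1, v2))%:R.

Let q (i : 'I_n) : S * (msg1 c * {ffun 'I_n -> option S}) * msg2 c -> R :=
  law P [% fun s : {ffun 'I_n -> S} => s i, U i, J].

Let map_set_coord (T T' : finType) (f : T -> T') (i : 'I_n) t (s : {ffun 'I_n -> T}) :
  map_seq f (set_coord i t s) = set_coord i (f t) (map_seq f s).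
Proof. by apply/ffunP => j; rewrite !ffunE; case: ifP. Qed.

Let prefix_set_coord (i : 'I_n) t (s : {ffun 'I_n -> S}) :
  prefix i (set_coord i t s) = prefix i s.
Proof.
apply/prefix_eq => j ji; rewrite ffunE; case: eqP => // ij.
by rewrite ij ltnn in ji.
Qed.

Let qE i w : q i w = p w.1.1 * K i w.1.1.1 w.1.2 w.2.
Proof.
case: w => [[t v1] v2] /=; rewrite /K.
transitivity (law P [% fun s : {ffun 'I_n -> S} => s i, [% U i, J]] (t, (v1, v2))).
  by apply: eq_law => s; rewrite /rv_pair !xpair_eqE andbA.
rewrite (law_iid_pair hp); congr (_ * _); apply: eq_bigr => s _.
congr (_ * (_ == _)%:R).
by rewrite /U /J /I /rv_pair /code_J1 /code_I1 !map_set_coord prefix_set_coord.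
Qed.

Lemma converse_hat_slices i : hat_slices p (q i)
  (mutual_info P (fun s => (s i).1.1) (U i),
   cond_mutual_info P (fun s => (s i).1.2) J (U i),
   mutual_info P (fun s => (s i).2) [% U i, J]).
Proof.
have -> : mutual_info P (fun s => (s i).1.1) (U i) = mutual_info (q i) rv_X1 rv_V1.
  by apply: mutual_info_ext => x v; rewrite law_comp.
have -> : cond_mutual_info P (fun s => (s i).1.2) J (U i) =
    cond_mutual_info (q i) rv_X2 rv_V2 rv_V1.
  by apply: cond_mutual_info_ext => x v2 v1; rewrite law_comp.
have -> : mutual_info P (fun s => (s i).2) [% U i, J] =
    mutual_info (q i) rv_Y [% rv_V1, rv_V2].
  by apply: mutual_info_ext => y v; rewrite law_comp.
pose K1 (a : A1) (v1 : msg1 c * {ffun 'I_n -> option S}) : R :=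
  \sum_s P s * ((enc1 c (set_coord i a (map_seq (@src_X1 A1 A2 B) s)), prefix i s)
    == v1)%:R.
apply: (@hat_slices_channel _ _ _ _ _ _ _ _ (K i) K1) => //.
- by move=> a v1 v2; apply: sumr_ge0 => s _; rewrite mulr_ge0 // hP.1.
- move=> a v1; rewrite /K1 -lawE -(law_margr _ _ (fun s => enc2
    (set_coord i a.2 (map_seq (@src_X2 A1 A2 B) s),
     enc1 c (set_coord i a.1 (map_seq (@src_X1 A1 A2 B) s))))).
  by apply: eq_bigr => v2 _; rewrite lawE.
- by move=> a; under eq_bigr do rewrite /K1 -lawE; rewrite sum_law hP.2.
Qed.

End Converse.

(** One code of positive length [n0.+1] is enough for each eps; the limit is left to
    [hat_closed]. *)
Lemma achievable_hat (R : realType) (A1 A2 B : finType) (p : A1 * A2 * B -> R)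
    R1 R2 mu eps :
  is_pmf p -> R_CDIB p (R1, R2, mu) -> 0 < eps ->
  single_letter_hat p (R1 + eps, R2 + eps, mu - eps).
Proof.
move=> hp [_ _ _ ach] eps0; have [n0 /(_ n0.+1 (ltnSn _)) [c [r1 r2 r3]]] := ach eps eps0.
have [q hq] := time_sharing (ltn0Sn n0) (converse_hat_slices hp c).
have nV0 : 0 <= n0.+1%:R^-1 :> R by rewrite invr_ge0.
exists _, _, q; apply/(hat_slicesP hp q (R1 + eps, R2 + eps, mu - eps)).
apply: hat_slices_weaken hq _ _ _ => /=.
- by apply: le_trans r1; rewrite ler_wpM2l // converse_rate1.
- by apply: le_trans r2; rewrite ler_wpM2l // converse_rate2.
- by apply: (le_trans r3); rewrite ler_wpM2l // converse_info.
Qed.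

Theorem corollary1 (R : realType) (A1 A2 B : finType) (p : A1 * A2 * B -> R)
    (hp : is_pmf p)
    (hM : markov_chain p (@src_X1 A1 A2 B) (@src_X2 A1 A2 B) (@src_Y A1 A2 B)) :
  R_CDIB_tilde p = R_CDIB_hat p /\ R_CDIB_hat p = R_CDIB p.
Proof.
split; apply/seteqP; split=> -[[R1 R2] mu].
- case=> R10 R20 mu0 sl; split=> //.
  exact: (@tilde_hat _ _ _ _ p (R1, R2, mu)).
- case=> R10 R20 mu0 sl; split=> //.
  by apply: (@kernel_tilde _ _ _ _ p hp (R1, R2, mu)); apply: hat_kernel.
- case=> R10 R20 mu0 sl; apply: kernel_achievable => //.
  exact: (@hat_kernel _ _ _ _ p hp hM (R1, R2, mu)).
- move=> ach; have [R10 R20 mu0 _] := ach; split=> //.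
  apply: (@hat_closed _ _ _ _ p hp R1 R2 mu) => eps eps0.
  exact: achievable_hat.
Qed.
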